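(* Let $\mathcal G$ be a finite nonempty reduced collection of allowed words of $\Sigma_A$ (no word of $\mathcal G$ is a subword of another word of $\mathcal G$). For $i\in\Sigma\setminus\mathcal G$ (symbols that are not themselves words in $\mathcal G$) and $n\ge1$, let $\mu(n,i)$ be the total $\mu$-measure of the cylinders $C_w$ over allowed words $w$ of length $n$ ending with $i$ and containing no word of $\mathcal G$ as a subword, and let $\mathcal F(z)=\sum_{i\in\Sigma\setminus\mathcal G}\sum_{n\ge1}\mu(n,i)z^n$. Then the radius of convergence of $\mathcal F$ equals $\exp(\rho(H_{\mathcal G}))$, and $z=\exp(\rho(H_{\mathcal G}))$ is a pole of $\mathcal F$.
   Context: Let $\Sigma=\{1,\dots,N\}$, $A$ an irreducible $N\times N$ $0$–$1$ matrix, $\Sigma_A=\{x\in\Sigma^{\mathbb N}:A_{x_nx_{n+1}}=1\ \forall n\}$ with left shift $\sigma$. A word is allowed if it occurs (as consecutive symbols) in some element of $\Sigma_A$; $C_w$ is the set of $x\in\Sigma_A$ beginning with $w$. $P$ is a row-stochastic matrix with $P_{ij}>0$ iff $A_{ij}=1$, $\mathbf p$ its stationary vector, $\mu=\mu_P$ the Markov measure $\mu(C_w)=p_{w_1}P_{w_1w_2}\cdots P_{w_{n-1}w_n}$. $H_{\mathcal G}=\bigcup_{w\in\mathcal G}C_w$; $\mathcal W_m=\{x:\sigma^ix\notin H_{\mathcal G},0\le i\le m\}$, $\rho(H_{\mathcal G})=-\lim_m\frac1m\ln\mu(\mathcal W_m)$.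
   Formalization: The formal theorem adds that μ(W_m)>0 for all m, so that ρ(H_G) is a finite real number; otherwise (e.g. when G consists of all symbols, so F=0) ln μ(W_m) is undefined and exp(ρ) cannot be a pole. *)

(* Defs.v *)
From Stdlib Require Import Reals List Arith Relations ClassicalDescription.
From Coquelicot Require Import Coquelicot.
Import ListNotations.
Open Scope R_scope.

(* Alphabet Sigma = {0,...,N-1} (the paper's {1,...,N} shifted by one). *)

Definition Rsum {T : Type} (l : list T) (f : T -> R) : R :=
  fold_right (fun x acc => f x + acc) 0 l.

Fixpoint words (N n : nat) : list (list nat) :=
  match n with
  | O => [nil]
  | S n' => flat_map (fun a => map (cons a) (words N n')) (seq 0 N)
  end.

Definition ind (P : Prop) : R :=
  if excluded_middle_informative P then 1 else 0.

Definition irreducible (N : nat) (A : nat -> nat -> bool) : Prop :=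
  forall i j, (i < N)%nat -> (j < N)%nat ->
    clos_trans nat (fun a b => (a < N)%nat /\ (b < N)%nat /\ A a b = true) i j.

Definition in_SigmaA (N : nat) (A : nat -> nat -> bool) (x : nat -> nat) : Prop :=
  forall n, (x n < N)%nat /\ A (x n) (x (S n)) = true.

Definition shift (k : nat) (x : nat -> nat) : nat -> nat := fun n => x (k + n)%nat.

Definition begins_with (w : list nat) (x : nat -> nat) : Prop :=
  forall t, (t < length w)%nat -> x t = nth t w 0%nat.

Definition allowed N A (w : list nat) : Prop :=
  exists x, in_SigmaA N A x /\ exists k, begins_with w (shift k x).

Definition cyl N A (w : list nat) (x : nat -> nat) : Prop :=
  in_SigmaA N A x /\ begins_with w x.

Definition subword (u w : list nat) : Prop := exists a b, w = a ++ u ++ b.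

Definition HG N A (G : list (list nat)) (x : nat -> nat) : Prop :=
  exists w, In w G /\ cyl N A w x.

Definition Wm N A (G : list (list nat)) (m : nat) (x : nat -> nat) : Prop :=
  in_SigmaA N A x /\ forall i, (i <= m)%nat -> ~ HG N A G (shift i x).

Fixpoint trans (P : nat -> nat -> R) (a : nat) (r : list nat) : R :=
  match r with
  | nil => 1
  | b :: r' => P a b * trans P b r'
  end.

Definition mu_cyl (p : nat -> R) (P : nat -> nat -> R) (w : list nat) : R :=
  match w with
  | nil => 1
  | a :: r => p a * trans P a r
  end.

(* Markov measure of a set S that is a union of cylinders of length k:
   S is the disjoint union of the C_w, w allowed of length k, with C_w ⊆ S. *)
Definition mu_fin N A p P (k : nat) (S : (nat -> nat) -> Prop) : R :=
  Rsum (words N k)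
    (fun w => ind (allowed N A w /\ forall x, cyl N A w x -> S x) * mu_cyl p P w).

Definition maxlen (G : list (list nat)) : nat := fold_right max 0%nat (map (@length nat) G).

(* mu(W_m): W_m depends only on the first m + maxlen G coordinates *)
Definition mu_W N A p P (G : list (list nat)) (m : nat) : R :=
  mu_fin N A p P (m + maxlen G) (Wm N A G m).

Definition mu_ni N A p P (G : list (list nat)) (n i : nat) : R :=
  Rsum (words N n)
    (fun w => ind (allowed N A w /\ (exists u, w = u ++ [i]) /\
                   forall g, In g G -> ~ subword g w) * mu_cyl p P w).

Definition Fcoef N A p P (G : list (list nat)) (n : nat) : R :=
  match n with
  | O => 0
  | S _ => Rsum (seq 0 N) (fun i => ind (~ In [i] G) * mu_ni N A p P G n i)
  end.

(* z0 (real, = radius of convergence) is a pole of the power series sum a_n z^n: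
   near z0 the sum equals g(z)/(z-z0)^k, with k >= 1 and g analytic
   (a convergent power series centred at z0) with g(z0) <> 0. *)
Definition is_pole_of_pseries (a : nat -> R) (z0 : R) : Prop :=
  exists k : nat, (1 <= k)%nat /\
  exists eps : R, 0 < eps /\
  exists b : nat -> C, b 0%nat <> RtoC 0 /\
  forall z : C, Cmod (Cminus z (RtoC z0)) < eps ->
    (exists gz : C, is_pseries b (Cminus z (RtoC z0)) gz) /\
    (Cmod z < z0 ->
       forall Fz gz : C,
         is_pseries (fun n => RtoC (a n)) z Fz ->
         is_pseries b (Cminus z (RtoC z0)) gz ->
         Cmult (pow_n (Cminus z (RtoC z0)) k) Fz = gz).

(* Main.v *)
(* Let [a n] be the mass of the [G]-avoiding words of length [n], and [L] the maximal length of a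
   word of [G].  Comparing words gives [a (m + L) <= mu (W_m) <= a (m + 1)], so [a n] decays at
   rate [rho].  The Markov property and the positivity of the stationary vector give
   [a (m + n) <= C * a m * a n], and Fekete's argument then yields [a n >= exp (- rho * n) / C]:
   the radius of convergence is [z0 = exp rho], and the sum is unbounded along the reals below
   [z0].  Finally [a] satisfies a linear recurrence, because [a (L + n)] is a fixed linear form of a
   vector indexed by the words of length [L] that evolves linearly in [n].  Hence the sum is a
   quotient of two polynomials, and being unbounded near [z0] it has a pole there. *)

Require Import Defs.
From Stdlib Require Import Reals List Arith Relations Lra Lia Permutation ClassicalDescription.
From Coquelicot Require Import Coquelicot.
Import ListNotations.
Open Scope R_scope.

(* [ind] of Rtopology would otherwise shadow the indicator function. *)
Local Notation ind := Defs.ind.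

(** * Complex polynomials and power series *)

(** The limit defining [rho] fixes the radius but not the behaviour at [z0]: it alone would permit
    coefficients like [exp (- rho * n) / n ^ 2], whose sum stays bounded up to [z0]. Hence the need
    for a lower bound without subexponential loss; it gives [F x >= c * x / (z0 - x)] on the reals
    below [z0] and places the singularity at [z0] itself. The constant is [C = / c] with [c] a
    positive lower bound of [p]: when two words are glued, the transition probability into the
    second word is at most 1, while the measure of that word alone carries a factor [p b >= c]. A
    pole is defined by an expansion centred at [z0]. So both polynomials are rewritten in
    [w = z - z0], their powers of [w] are split off, and the remaining quotient is expanded by
    formal division, with a geometric bound on its coefficients. The recurrence comes from counting
    dimensions: [D + 1] vectors indexed by [D] words are dependent. Any nontrivial relation yields a
    nonzero denominator, so no characteristic polynomial has to be computed. *)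

Fixpoint peval (q : list C) (z : C) : C :=
  match q with
  | nil => RtoC 0
  | c :: q' => Cplus c (Cmult z (peval q' z))
  end.

(** Cauchy product of a polynomial and a series. The recursion follows
    [(c + X q) b = c b + X (q b)], so evaluation reduces to [PS_scal], [PS_plus] and [PS_incr_1]. *)
Fixpoint pmul (q : list C) (b : nat -> C) (n : nat) : C :=
  match q with
  | nil => RtoC 0
  | c :: q' => Cplus (Cmult c (b n))
                     (match n with O => RtoC 0 | S m => pmul q' b m end)
  end.

Definition cnonzero (q : list C) : Prop := exists c, In c q /\ c <> RtoC 0.

Definition is_poly (f : C -> C) : Prop := exists q, forall z, f z = peval q z.

Lemma is_pseries_pmul (q : list C) (b : nat -> C) (z g : C) :
  is_pseries (V := C_NormedModule) b z g ->
  is_pseries (V := C_NormedModule) (pmul q b) z (Cmult (peval q z) g).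
Proof.
  intros H; induction q as [|c q IH].
  - replace (Cmult (peval nil z) g) with (@scal C_AbsRing C_NormedModule (RtoC 0) g)
      by reflexivity.
    apply is_pseries_ext with (PS_scal (V := C_NormedModule) (RtoC 0 : C_AbsRing) b).
    + intros n; unfold PS_scal; change (Cmult (RtoC 0) (b n) = RtoC 0); ring.
    + apply (is_pseries_scal (V := C_NormedModule)); [apply Cmult_comm | exact H].
  - replace (Cmult (peval (c :: q) z) g)
      with (@plus C_NormedModule (@scal C_AbsRing C_NormedModule c g)
              (@scal C_AbsRing C_NormedModule z (Cmult (peval q z) g))).
    2: { change (Cplus (Cmult c g) (Cmult z (Cmult (peval q z) g)) =
                 Cmult (Cplus c (Cmult z (peval q z))) g); ring. }
    apply is_pseries_ext with
      (PS_plus (PS_scal (V := C_NormedModule) (c : C_AbsRing) b)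
               (PS_incr_1 (V := C_NormedModule) (pmul q b))).
    + intros [|n]; reflexivity.
    + apply (is_pseries_plus (V := C_NormedModule)).
      * apply (is_pseries_scal (V := C_NormedModule)); [apply Cmult_comm | exact H].
      * apply (is_pseries_incr_1 (V := C_NormedModule)); exact IH.
Qed.

Lemma is_pseries_C_unique (b : nat -> C) (z g h : C) :
  is_pseries (V := C_NormedModule) b z g ->
  is_pseries (V := C_NormedModule) b z h -> g = h.
Proof.
  intros Hg Hh.
  exact (filterlim_locally_unique (V := C_NormedModule) _ g h Hg Hh).
Qed.

Lemma is_pseries_C_finite (M : nat) : forall (t : nat -> C) (z : C),
  (forall n, (M <= n)%nat -> t n = RtoC 0) ->
  is_pseries (V := C_NormedModule) t z (peval (map t (seq 0 M)) z).
Proof.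
  induction M as [|M IH]; intros t z Ht.
  - apply filterlim_ext with (fun _ : nat => RtoC 0).
    2: apply filterlim_const.
    intros n; induction n as [|n IHn].
    + rewrite sum_O, Ht by lia. symmetry; apply (scal_zero_r (V := C_NormedModule)).
    + rewrite sum_Sn, <- IHn, Ht by lia. symmetry.
      etransitivity; [apply (plus_zero_l (G := C_NormedModule))|].
      apply (scal_zero_r (V := C_NormedModule)).
  - cbn [seq map peval].
    rewrite <- seq_shift, map_map.
    apply is_pseries_ext with
      (PS_plus (V := C_NormedModule) (fun n => match n with O => t 0%nat | S _ => RtoC 0 end)
         (PS_incr_1 (V := C_NormedModule) (fun n => t (S n)))).
    + intros [|n]; [apply (plus_zero_r (G := C_NormedModule))
                   |apply (plus_zero_l (G := C_NormedModule))].
    + apply (is_pseries_plus (V := C_NormedModule)).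
      * apply filterlim_ext with (fun _ : nat => t 0%nat).
        2: apply filterlim_const.
        intros n; induction n as [|n IHn].
        -- rewrite sum_O. symmetry; apply (scal_one (V := C_NormedModule)).
        -- rewrite sum_Sn, <- IHn.
           symmetry; etransitivity; [|apply (plus_zero_r (G := C_NormedModule))].
           f_equal. apply (scal_zero_r (V := C_NormedModule)).
      * apply (is_pseries_incr_1 (V := C_NormedModule)).
        apply IH; intros n Hn; apply Ht; lia.
Qed.

Lemma is_poly_const (c : C) : is_poly (fun _ => c).
Proof. exists [c]; intros z; simpl; ring. Qed.

Lemma is_poly_plus (f g : C -> C) :
  is_poly f -> is_poly g -> is_poly (fun z => Cplus (f z) (g z)).
Proof.
  intros [q Hq] [r Hr].
  enough (H : exists s, forall z, Cplus (peval q z) (peval r z) = peval s z).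
  { destruct H as [s Hs]; exists s; intros z; rewrite Hq, Hr; apply Hs. }
  clear - q; revert r; induction q as [|c q IH]; intros r.
  - exists r; intros z; simpl; ring.
  - destruct r as [|d r].
    + exists (c :: q); intros z; simpl; ring.
    + destruct (IH r) as [s Hs]; exists (Cplus c d :: s); intros z; simpl.
      rewrite <- Hs; ring.
Qed.

Lemma is_poly_scal (c : C) (f : C -> C) : is_poly f -> is_poly (fun z => Cmult c (f z)).
Proof.
  intros [q Hq]; exists (map (Cmult c) q); intros z; rewrite Hq.
  clear; induction q as [|d q IH]; simpl; [ring|rewrite <- IH; ring].
Qed.

Lemma is_poly_mult_X (f : C -> C) : is_poly f -> is_poly (fun z => Cmult z (f z)).
Proof. intros [q Hq]; exists (RtoC 0 :: q); intros z; rewrite Hq; simpl; ring. Qed.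

(** Horner's scheme with [w + c] in place of the variable. It recentres polynomials at [z0]. *)
Lemma is_poly_peval_shift (q : list C) (c : C) : is_poly (fun w => peval q (Cplus w c)).
Proof.
  induction q as [|d q IH]; simpl.
  - apply is_poly_const.
  - apply is_poly_plus; [apply is_poly_const|].
    destruct (is_poly_plus _ _ (is_poly_mult_X _ IH) (is_poly_scal c _ IH)) as [s Hs].
    exists s; intros z; rewrite <- Hs; ring.
Qed.

Lemma cnonzero_of_peval (q : list C) (w : C) : peval q w <> RtoC 0 -> cnonzero q.
Proof.
  induction q as [|c q IH]; intros H; [exfalso; apply H; reflexivity|].
  destruct (Ceq_dec c (RtoC 0)) as [->|Hc]; [|exists c; split; [left; reflexivity|exact Hc]].
  destruct IH as [d [Hd Hd0]]; [|exists d; split; [right; exact Hd|exact Hd0]].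
  intros E; apply H; cbn [peval]; rewrite E; ring.
Qed.

(** Leading zeros of the coefficient list are stripped; [j] is the order of vanishing at 0, hence at
    [z0] for a recentred polynomial. *)
Lemma peval_factor_X (q : list C) : cnonzero q ->
  exists j c r, c <> RtoC 0 /\
    forall w, peval q w = Cmult (Cpow w j) (peval (c :: r) w).
Proof.
  intros [x [Hx Hx0]]; induction q as [|d q IH]; [destruct Hx|].
  destruct (Ceq_dec d (RtoC 0)) as [->|Hd].
  - destruct Hx as [Hx|Hx]; [congruence|].
    destruct (IH Hx) as (j & c & r & Hc & H).
    exists (S j), c, r; split; [exact Hc|]; intros w.
    cbn [peval]; rewrite H; cbn [Cpow peval]; ring.
  - exists 0%nat, d, q; split; [exact Hd|]; intros w; cbn [Cpow]; ring.
Qed.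

Lemma peval_bounded (q : list C) :
  exists B, 0 <= B /\ forall w, Cmod w <= 1 -> Cmod (peval q w) <= B.
Proof.
  induction q as [|c q [B [HB H]]].
  - exists 0; split; [lra|]; intros w _; simpl; rewrite Cmod_0; lra.
  - exists (Cmod c + B); split; [generalize (Cmod_ge_0 c); lra|]; intros w Hw; simpl.
    eapply Rle_trans; [apply Cmod_triangle|]; apply Rplus_le_compat_l.
    rewrite Cmod_mult; specialize (H w Hw).
    generalize (Cmod_ge_0 w) (Cmod_ge_0 (peval q w)); nra.
Qed.

Lemma peval_away_from_0 (c : C) (q : list C) : c <> RtoC 0 ->
  exists eps, 0 < eps <= 1 /\
    forall w, Cmod w < eps -> Cmod c / 2 <= Cmod (peval (c :: q) w).
Proof.
  intros Hc; destruct (peval_bounded q) as [B [HB H]].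
  assert (Hc' : 0 < Cmod c) by (apply Cmod_gt_0; exact Hc).
  (* Chosen so that [w * q w] has modulus at most [Cmod c / 2]. The cap 1 makes the bound [B]
     available, and [B + 1] avoids dividing by zero when [B = 0]. *)
  exists (Rmin 1 (Cmod c / (2 * (B + 1)))).
  assert (Hd : 0 < Cmod c / (2 * (B + 1))) by (apply Rdiv_lt_0_compat; lra).
  split; [split; [apply Rmin_pos; lra|apply Rmin_l]|].
  intros w Hw.
  assert (Hw1 : Cmod w <= 1) by (generalize (Rmin_l 1 (Cmod c / (2 * (B + 1)))); lra).
  assert (Hw2 : Cmod w < Cmod c / (2 * (B + 1)))
    by (generalize (Rmin_r 1 (Cmod c / (2 * (B + 1)))); lra).
  specialize (H w Hw1).
  assert (Hprod : Cmod (Cmult w (peval q w)) <= Cmod c / 2).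
  { rewrite Cmod_mult.
    replace (Cmod c / 2) with (Cmod c / (2 * (B + 1)) * (B + 1)) by (field; lra).
    apply Rmult_le_compat; try apply Cmod_ge_0; lra. }
  cbn [peval].
  assert (Ht := Cmod_triangle (Cplus c (Cmult w (peval q w))) (Copp (Cmult w (peval q w)))).
  rewrite Cmod_opp in Ht.
  replace (Cplus (Cplus c (Cmult w (peval q w))) (Copp (Cmult w (peval q w)))) with c in Ht by ring.
  lra.
Qed.

Lemma pow_n_Cpow (z : C) (n : nat) : pow_n (K := C_Ring) z n = Cpow z n.
Proof. induction n as [|n IH]; [reflexivity|]; cbn [pow_n Cpow]; rewrite IH; reflexivity. Qed.

(** * Division of power series by a polynomial with nonzero constant term *)

Fixpoint cdot (q l : list C) : C :=
  match q, l with
  | c :: q', x :: l' => Cplus (Cmult c x) (cdot q' l')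
  | _, _ => RtoC 0
  end.

(* [quot_prefix c q t n] lists, in reverse order, the first [n] coefficients of the formal
   power series [t / (c + X q)]. *)
Fixpoint quot_prefix (c : C) (q : list C) (t : nat -> C) (n : nat) : list C :=
  match n with
  | O => nil
  | S m => Cdiv (Cminus (t m) (cdot q (quot_prefix c q t m))) c :: quot_prefix c q t m
  end.

Definition quot (c : C) (q : list C) (t : nat -> C) (n : nat) : C :=
  Cdiv (Cminus (t n) (cdot q (quot_prefix c q t n))) c.

(** Reversal of the prefix aligns entry [k] of [r] with coefficient [n - k], so a convolution
    becomes a dot product. [cdot] stops at the shorter list, which discards the negative indices. *)
Lemma pmul_quot_prefix (c : C) (q : list C) (t : nat -> C) (r : list C) : forall n,
  pmul r (quot c q t) n = cdot r (quot_prefix c q t (S n)).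
Proof.
  induction r as [|d r IH]; intros n; [reflexivity|].
  cbn [pmul]; change (quot_prefix c q t (S n)) with (quot c q t n :: quot_prefix c q t n).
  cbn [cdot]; f_equal.
  destruct n as [|n]; [destruct r; reflexivity|apply IH].
Qed.

Lemma pmul_quot (c : C) (q : list C) (t : nat -> C) (n : nat) : c <> RtoC 0 ->
  pmul (c :: q) (quot c q t) n = t n.
Proof.
  intros Hc; rewrite pmul_quot_prefix.
  change (quot_prefix c q t (S n)) with (quot c q t n :: quot_prefix c q t n).
  cbn [cdot]; unfold quot; field; exact Hc.
Qed.

Lemma Cmod_cdot_le (q : list C) :
  exists S, 0 <= S /\ forall l X, 0 <= X -> (forall x, In x l -> Cmod x <= X) ->
    Cmod (cdot q l) <= S * X.
Proof.
  induction q as [|c q [S [HS IH]]].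
  - exists 0; split; [lra|]; intros l X HX _; simpl; rewrite Cmod_0; lra.
  - exists (Cmod c + S); generalize (Cmod_ge_0 c); intros Hc; split; [lra|].
    intros [|x l] X HX Hl; simpl.
    + rewrite Cmod_0; nra.
    + eapply Rle_trans; [apply Cmod_triangle|]; rewrite Cmod_mult.
      specialize (IH l X HX (fun y Hy => Hl y (or_intror Hy))).
      specialize (Hl x (or_introl eq_refl)); generalize (Cmod_ge_0 x); nra.
Qed.

Lemma quot_bounded (c : C) (q : list C) (t : nat -> C) (T : R) : c <> RtoC 0 ->
  (forall n, Cmod (t n) <= T) ->
  exists K r, 0 <= K /\ 1 <= r /\ forall n, Cmod (quot c q t n) <= K * r ^ n.
Proof.
  intros Hc Ht; destruct (Cmod_cdot_le q) as [S [HS Hdot]].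
  assert (Hc' : 0 < Cmod c) by (apply Cmod_gt_0; exact Hc).
  assert (HT : 0 <= T) by (generalize (Ht 0%nat) (Cmod_ge_0 (t 0%nat)); lra).
  (* In the bound [(T + S * previous) / Cmod c] on a new coefficient, [K] lets [T] take at most half
     of the budget and [r] lets the earlier coefficients take the other half. With [r >= 1] the
     majorant is monotone, so its last value bounds the whole prefix. *)
  pose (K := 2 * T / Cmod c); pose (r := Rmax 1 (2 * S / Cmod c)).
  assert (HK : 0 <= K) by (apply Rdiv_le_0_compat; lra).
  assert (Hr1 : 1 <= r) by apply Rmax_l.
  assert (Hr2 : 2 * S <= r * Cmod c).
  { apply Rmult_le_reg_r with (/ Cmod c); [apply Rinv_0_lt_compat; lra|].
    replace (r * Cmod c * / Cmod c) with r by (field; lra); apply Rmax_r. }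
  assert (HKc : K * Cmod c = 2 * T) by (unfold K; field; lra).
  assert (step : forall n X, 0 <= X -> T <= Cmod c * X / 2 -> S * (X / r) <= Cmod c * X / 2 ->
    (forall x, In x (quot_prefix c q t n) -> Cmod x <= X / r) -> Cmod (quot c q t n) <= X).
  { intros n X HX H1 H2 Hpre; unfold quot; rewrite Cmod_div by exact Hc.
    apply Rmult_le_reg_r with (Cmod c); [lra|].
    replace (Cmod (t n - cdot q (quot_prefix c q t n)) / Cmod c * Cmod c)
      with (Cmod (t n - cdot q (quot_prefix c q t n))) by (field; lra).
    assert (H0 : 0 <= X / r) by (apply Rdiv_le_0_compat; lra).
    specialize (Hdot _ _ H0 Hpre); specialize (Ht n).
    unfold Cminus; eapply Rle_trans; [apply Cmod_triangle|]; rewrite Cmod_opp; lra. }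
  assert (Hstep : forall n, (forall x, In x (quot_prefix c q t n) -> Cmod x <= K * r ^ n / r) ->
    Cmod (quot c q t n) <= K * r ^ n).
  { intros n Hpre; assert (Hrn := pow_R1_Rle r n Hr1).
    assert (HX : 0 <= K * r ^ n) by nra.
    apply step; [exact HX| | |exact Hpre].
    { replace (Cmod c * (K * r ^ n) / 2) with (T * r ^ n); [nra|].
      rewrite <- Rmult_assoc, (Rmult_comm (Cmod c)), HKc; field. }
    apply Rmult_le_reg_r with r; [lra|].
    replace (S * (K * r ^ n / r) * r) with (S * (K * r ^ n)) by (field; lra); nra. }
  assert (Hpre : forall n x, In x (quot_prefix c q t n) -> Cmod x <= K * r ^ n / r).
  { induction n as [|n IH]; [intros x []|].
    replace (K * r ^ Datatypes.S n / r) with (K * r ^ n) by (simpl; field; lra).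
    intros x [<-|Hx]; [exact (Hstep n IH)|].
    eapply Rle_trans; [exact (IH x Hx)|].
    assert (HX : 0 <= K * r ^ n) by (apply Rmult_le_pos; [lra|apply pow_le; lra]).
    apply Rmult_le_reg_r with r; [lra|].
    replace (K * r ^ n / r * r) with (K * r ^ n) by (field; lra); nra. }
  exists K, r; split; [exact HK|split; [exact Hr1|]]; intros n; apply Hstep, Hpre.
Qed.

Lemma ex_pseries_C_of_bound (b : nat -> C) (K r : R) (z : C) : 0 < r ->
  (forall n, Cmod (b n) <= K * r ^ n) -> Cmod z < / r ->
  exists g : C, is_pseries (V := C_NormedModule) b z g.
Proof.
  intros Hr Hb Hz.
  apply (ex_series_le (V := C_CompleteNormedModule) _ (fun n => K * (r * Cmod z) ^ n)).
  - intros n; change (Cmod (Cmult (pow_n (K := C_Ring) z n) (b n)) <= K * (r * Cmod z) ^ n).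
    rewrite pow_n_Cpow, Cmod_mult, Cmod_pow, Rpow_mult_distr.
    specialize (Hb n); assert (H := pow_le _ n (Cmod_ge_0 z)); nra.
  - apply (ex_series_scal_l (K := R_AbsRing) K (fun n => (r * Cmod z) ^ n)).
    apply ex_series_geom.
    rewrite Rabs_pos_eq by (generalize (Cmod_ge_0 z); nra).
    apply Rmult_lt_reg_l with (/ r); [apply Rinv_0_lt_compat; lra|].
    rewrite <- Rmult_assoc, Rinv_l, Rmult_1_l, Rmult_1_r by lra; exact Hz.
Qed.

(** Formal division of [s] by [c + X q] converges near 0 because its coefficients grow at most
    geometrically. This supplies the analytic factor in the definition of a pole; the value of [b 0]
    serves to show that it does not vanish at the centre. *)
Lemma pseries_quotient (c : C) (q s : list C) : c <> RtoC 0 ->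
  exists b : nat -> C, Cmult c (b 0%nat) = peval s (RtoC 0) /\
  exists eps, 0 < eps /\ forall w, Cmod w < eps ->
    (exists g : C, is_pseries (V := C_NormedModule) b w g) /\
    forall g : C, is_pseries (V := C_NormedModule) b w g ->
      Cmult (peval (c :: q) w) g = peval s w.
Proof.
  intros Hc.
  pose (t := fun n => nth n s (RtoC 0)).
  assert (Hmap : map t (seq 0 (length s)) = s).
  { apply nth_ext with (RtoC 0) (RtoC 0).
    - rewrite length_map, length_seq; reflexivity.
    - intros n Hn; rewrite length_map, length_seq in Hn.
      rewrite (nth_indep _ _ (t 0%nat)) by (rewrite length_map, length_seq; exact Hn).
      rewrite map_nth, seq_nth by exact Hn; reflexivity. }
  assert (HT : exists T, forall n, Cmod (t n) <= T).
  { exists (fold_right (fun x y => Cmod x + y) 0 s); unfold t; clear.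
    assert (H0 : forall s, 0 <= fold_right (fun x y => Cmod x + y) 0 s).
    { clear; induction s as [|x s IH]; simpl; [lra|generalize (Cmod_ge_0 x); lra]. }
    induction s as [|x s IH]; intros [|n]; simpl; try (rewrite Cmod_0; lra).
    - generalize (H0 s); lra.
    - generalize (IH n) (Cmod_ge_0 x); lra. }
  destruct HT as [T HT].
  destruct (quot_bounded c q t T Hc HT) as (K & r & HK & Hr & Hb).
  exists (quot c q t); split.
  - unfold quot; cbn [quot_prefix]; destruct q, s; simpl; unfold t; simpl; field; exact Hc.
  - exists (/ r); split; [apply Rinv_0_lt_compat; lra|]; intros w Hw; split.
    + apply ex_pseries_C_of_bound with K r; [lra|exact Hb|exact Hw].
    + intros g Hg.
      apply is_pseries_C_unique with (pmul (c :: q) (quot c q t)) w.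
      * apply is_pseries_pmul; exact Hg.
      * apply is_pseries_ext with t; [intros n; symmetry; apply pmul_quot, Hc|].
        rewrite <- Hmap; apply is_pseries_C_finite.
        intros n Hn; apply nth_overflow; exact Hn.
Qed.

(** * Poles of rational power series with real coefficients *)

Lemma is_pseries_RtoC (a : nat -> R) (x l : R) :
  is_pseries a x l -> is_pseries (V := C_NormedModule) (fun n => RtoC (a n)) (RtoC x) (RtoC l).
Proof.
  intros H; unfold is_pseries, is_series in *.
  apply filterlim_ext with (fun n => RtoC (sum_n (fun k => scal (pow_n x k) (a k)) n)).
  - intros n; induction n as [|n IH].
    + rewrite !sum_O; change (RtoC (1 * a 0%nat) = Cmult (RtoC 1) (RtoC (a 0%nat))).
      apply RtoC_mult.
    + rewrite !sum_Sn, <- IH.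
      rewrite pow_n_Cpow, <- RtoC_pow, pow_n_pow.
      change (RtoC (sum_n (fun k => scal (pow_n x k) (a k)) n + x ^ S n * a (S n)) =
              Cplus (RtoC (sum_n (fun k => scal (pow_n x k) (a k)) n))
                    (Cmult (RtoC (x ^ S n)) (RtoC (a (S n))))).
      rewrite RtoC_plus, RtoC_mult; reflexivity.
  - eapply filterlim_comp; [exact H|].
    intros Q [eps HQ]; exists eps; intros y Hy; apply HQ.
    split; [exact Hy|apply ball_center].
Qed.

(** In the variable [w = z - z0], the relation between [Q], the sum [F] and the numerator reads
    [w ^ j * u * F = w ^ l * v] with [u] and [v] nonzero at [w = 0]. Blow-up of [F] on the reals
    below [z0] forces [l < j], so the pole has order [j - l] and analytic factor [v / u]. *)
Lemma pole_of_rational_pseries (a : nat -> R) (z0 c0 : R) (Q : list C) (M : nat) :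
  0 < z0 -> 0 < c0 -> a 0%nat = 0 ->
  (forall n, (1 <= n)%nat -> c0 * (/ z0) ^ n <= a n) ->
  CV_radius a = Finite z0 ->
  cnonzero Q -> (forall n, (M <= n)%nat -> pmul Q (fun k => RtoC (a k)) n = RtoC 0) ->
  is_pole_of_pseries a z0.
Proof.
  intros Hz0 Hc0 Ha0 Ha Hrad HQ Hrec.
  set (ac := fun k => RtoC (a k)) in *.
  (* The numerator: by [Hrec] the product of [Q] and the series has no coefficients from index [M]
     on. *)
  pose (Nm := map (pmul Q ac) (seq 0 M)).
  assert (HQF : forall z F : C, is_pseries (V := C_NormedModule) ac z F ->
                Cmult (peval Q z) F = peval Nm z).
  { intros z F HF; apply is_pseries_C_unique with (pmul Q ac) z.
    - apply is_pseries_pmul; exact HF.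
    - apply is_pseries_C_finite; exact Hrec. }
  (* [c0 * x / (z0 - x)] is the sum of [c0 * (x / z0) ^ n] over [n >= 1]. *)
  assert (Hreal : forall x, 0 < x < z0 -> exists F : R,
     is_pseries (V := C_NormedModule) ac (RtoC x) (RtoC F) /\ c0 * x / (z0 - x) <= F).
  { intros x Hx.
    assert (Hex : ex_pseries a x).
    { apply CV_radius_inside; rewrite Hrad, Rabs_pos_eq by lra; simpl; lra. }
    exists (PSeries a x); split.
    - apply is_pseries_RtoC, PSeries_correct, Hex.
    (* The lower bound on [a] starts at index 1, so the zero term is split off before the comparison
       with a geometric series. *)
    - rewrite (PSeries_decr_1 a x Hex), Ha0, Rplus_0_l.
      assert (Hex' : ex_pseries (PS_decr_1 a) x).
      { apply CV_radius_inside; rewrite CV_radius_decr_1, Hrad, Rabs_pos_eq by lra; simpl; lra. }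
      assert (Hq : Rabs (x / z0) < 1).
      { rewrite Rabs_pos_eq by (apply Rdiv_le_0_compat; lra).
        apply Rmult_lt_reg_r with z0; [lra|]; unfold Rdiv.
        rewrite Rmult_assoc, Rinv_l by lra; lra. }
      replace (c0 * x / (z0 - x)) with (x * (c0 / z0 * Series (fun n => (x / z0) ^ n))).
      2: { rewrite (is_series_unique _ _ (is_series_geom _ Hq)); field; lra. }
      apply Rmult_le_compat_l; [lra|].
      rewrite <- Series_scal_l; unfold PSeries; apply Series_le.
      + intros n; unfold PS_decr_1.
        assert (H1 : 0 < x ^ n) by (apply pow_lt; lra).
        assert (H2 : 0 < (/ z0) ^ n) by (apply pow_lt, Rinv_0_lt_compat; lra).
        assert (H3 : 0 < / z0) by (apply Rinv_0_lt_compat; lra).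
        specialize (Ha (S n) ltac:(lia)); unfold Rdiv; rewrite Rpow_mult_distr.
        simpl in Ha; split.
        * repeat apply Rmult_le_pos; lra.
        * replace (c0 * / z0 * (x ^ n * (/ z0) ^ n)) with (c0 * (/ z0 * (/ z0) ^ n) * x ^ n) by ring.
          apply Rmult_le_compat_r; lra.
      + apply ex_pseries_R, Hex'. }
  destruct (is_poly_peval_shift Q (RtoC z0)) as [Q' HQ'].
  destruct (is_poly_peval_shift Nm (RtoC z0)) as [N' HN'].
  (* [Q] has a nonzero value at a small positive real, where neither the power of the variable nor
     its cofactor vanishes. Recentring preserves values, so [Q'] has a nonzero coefficient. *)
  assert (HQ'nz : cnonzero Q').
  { destruct (peval_factor_X Q HQ) as (j & c & r & Hc & Hfac).
    destruct (peval_away_from_0 c r Hc) as [eps [Heps Haway]].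
    assert (Hne : peval Q (RtoC (eps / 2)) <> RtoC 0).
    { rewrite Hfac; apply Cmult_neq_0.
      - apply Cpow_nz; intros H; apply RtoC_inj in H; lra.
      - apply Cmod_gt_0; apply Cmod_gt_0 in Hc.
        specialize (Haway (RtoC (eps / 2))); rewrite Cmod_R, Rabs_pos_eq in Haway; lra. }
    replace (RtoC (eps / 2)) with (Cplus (Cminus (RtoC (eps / 2)) (RtoC z0)) (RtoC z0)) in Hne by ring.
    rewrite HQ' in Hne.
    exact (cnonzero_of_peval _ _ Hne). }
  destruct (peval_factor_X Q' HQ'nz) as (j & c & q & Hc & HfacQ).
  destruct (peval_away_from_0 c q Hc) as [epsQ [HepsQ HawayQ]].
  assert (Hcpos : 0 < Cmod c) by (apply Cmod_gt_0; exact Hc).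
  assert (HQq : forall w, Cmod w < epsQ -> peval (c :: q) w <> RtoC 0).
  { intros w Hw; apply Cmod_gt_0; specialize (HawayQ w Hw); lra. }
  (* At the real point [z0 - d] the sum is positive and [Q] does not vanish, so their product, the
     numerator, is nonzero there. *)
  assert (HN'nz : cnonzero N').
  { pose (d := Rmin z0 epsQ / 2).
    assert (Hd : 0 < d < z0 /\ d < epsQ).
    { unfold d; generalize (Rmin_l z0 epsQ) (Rmin_r z0 epsQ) (Rmin_pos z0 epsQ); lra. }
    destruct (Hreal (z0 - d)) as [F [HF HFge]]; [lra|].
    assert (HFpos : 0 < F).
    { eapply Rlt_le_trans; [|exact HFge]; apply Rdiv_lt_0_compat; [|lra].
      apply Rmult_lt_0_compat; lra. }
    specialize (HQF _ _ HF).
    replace (RtoC (z0 - d)) with (Cplus (RtoC (- d)) (RtoC z0)) in HQF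
      by (rewrite <- RtoC_plus; f_equal; ring).
    rewrite HQ', HN', HfacQ in HQF.
    apply (cnonzero_of_peval _ (RtoC (- d))); rewrite <- HQF.
    repeat apply Cmult_neq_0.
    - apply Cpow_nz; intros H; apply RtoC_inj in H; lra.
    - apply HQq; rewrite Cmod_R, Rabs_left by lra; lra.
    - intros H; apply RtoC_inj in H; lra. }
  destruct (peval_factor_X N' HN'nz) as (l & e & s & He & HfacN).
  assert (Hmain : forall z F : C, is_pseries (V := C_NormedModule) ac z F ->
     let w := Cminus z (RtoC z0) in
     Cmult (Cmult (Cpow w j) (peval (c :: q) w)) F = Cmult (Cpow w l) (peval (e :: s) w)).
  { intros z F HF w; rewrite <- HfacQ, <- HfacN, <- HQ', <- HN'.
    replace (Cplus w (RtoC z0)) with z by (unfold w; ring); apply HQF; exact HF. }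
  (* Otherwise [w ^ j] cancels to [u * F = w ^ (l - j) * v], whose right side stays bounded near
     [w = 0] while [u] stays away from 0 and [F] grows without bound. *)
  assert (Hlj : (l < j)%nat).
  { destruct (le_lt_dec j l) as [Hjl|]; [exfalso|assumption].
    destruct (peval_bounded (e :: s)) as [B [HB HBs]].
    (* A value [F >= D] makes the left side at least [B + 1], against at most [B] on the right. The
       bounds [d <= z0 / 2] and [d <= c0 * z0 / (2 * D)] on the distance to [z0] make
       [c0 * (z0 - d) / d] reach [D]. *)
    pose (D := 2 * (B + 1) / Cmod c).
    assert (HD : 0 < D) by (apply Rdiv_lt_0_compat; lra).
    pose (d := Rmin (Rmin (z0 / 2) (epsQ / 2)) (c0 * z0 / (2 * D))).
    assert (HD' : 0 < c0 * z0 / (2 * D)) by (apply Rdiv_lt_0_compat; nra).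
    assert (Hd : 0 < d /\ d <= z0 / 2 /\ d <= epsQ / 2 /\ d <= c0 * z0 / (2 * D)).
    { unfold d; repeat split.
      - repeat apply Rmin_pos; lra.
      - eapply Rle_trans; [apply Rmin_l|apply Rmin_l].
      - eapply Rle_trans; [apply Rmin_l|apply Rmin_r].
      - apply Rmin_r. }
    destruct Hd as (Hd0 & Hd1 & Hd2 & Hd3).
    destruct (Hreal (z0 - d)) as [F [HF HFge]]; [lra|].
    replace (z0 - (z0 - d)) with d in HFge by ring.
    assert (HFD : D <= F).
    { eapply Rle_trans; [|exact HFge].
      apply Rmult_le_reg_r with d; [lra|].
      replace (c0 * (z0 - d) / d * d) with (c0 * (z0 - d)) by (field; lra).
      apply Rle_trans with (c0 * z0 / 2); [|nra].
      replace (c0 * z0 / 2) with (D * (c0 * z0 / (2 * D))) by (field; lra).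
      apply Rmult_le_compat_l; lra. }
    specialize (Hmain _ _ HF); cbv zeta in Hmain.
    replace (Cminus (RtoC (z0 - d)) (RtoC z0)) with (RtoC (- d)) in Hmain
      by (rewrite <- RtoC_minus; f_equal; ring).
    assert (Hdw : Cmod (RtoC (- d)) = d) by (rewrite Cmod_R, Rabs_left; lra).
    replace l with (j + (l - j))%nat in Hmain by lia.
    rewrite Cpow_add_r in Hmain.
    assert (Hw : Cpow (RtoC (- d)) j <> RtoC 0)
      by (apply Cpow_nz; intros H; apply RtoC_inj in H; lra).
    assert (Hcan : Cmult (peval (c :: q) (RtoC (- d))) (RtoC F) =
                   Cmult (Cpow (RtoC (- d)) (l - j)) (peval (e :: s) (RtoC (- d)))).
    { transitivity (Cmult (Cinv (Cpow (RtoC (- d)) j))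
        (Cmult (Cmult (Cpow (RtoC (- d)) j) (peval (c :: q) (RtoC (- d)))) (RtoC F))).
      - field; exact Hw.
      - rewrite Hmain; field; exact Hw. }
    apply (f_equal Cmod) in Hcan; rewrite !Cmod_mult, Cmod_pow, Hdw, Cmod_R in Hcan.
    rewrite (Rabs_pos_eq F) in Hcan by lra.
    specialize (HawayQ (RtoC (- d))); rewrite Hdw in HawayQ.
    specialize (HBs (RtoC (- d))); rewrite Hdw in HBs.
    assert (Hp : 0 <= d ^ (l - j) <= 1).
    { split; [apply pow_le; lra|]; rewrite <- (pow1 (l - j)); apply pow_incr; lra. }
    assert (HDc : D * (Cmod c / 2) = B + 1) by (unfold D; field; lra).
    assert (H1 : Cmod c / 2 * D <= Cmod (peval (c :: q) (RtoC (- d))) * F)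
      by (apply Rmult_le_compat; lra).
    assert (H2 : d ^ (l - j) * Cmod (peval (e :: s) (RtoC (- d))) <= 1 * B).
    { apply Rmult_le_compat; [lra|apply Cmod_ge_0|lra|apply HBs; lra]. }
    lra. }
  destruct (pseries_quotient c q (e :: s) Hc) as (b & Hb0 & epsb & Hepsb & Hb).
  exists (j - l)%nat; split; [lia|].
  exists (Rmin epsQ epsb); split; [apply Rmin_pos; lra|].
  exists b; split.
  - intros H; rewrite H in Hb0; apply He.
    cbn [peval] in Hb0; rewrite Cmult_0_l, Cplus_0_r, Cmult_0_r in Hb0; symmetry; exact Hb0.
  - intros z Hz.
    assert (HzQ : Cmod (Cminus z (RtoC z0)) < epsQ) by (generalize (Rmin_l epsQ epsb); lra).
    assert (Hzb : Cmod (Cminus z (RtoC z0)) < epsb) by (generalize (Rmin_r epsQ epsb); lra).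
    destruct (Hb _ Hzb) as [Hex Hval]; split; [exact Hex|].
    intros Hzlt Fz gz HFz Hgz.
    rewrite pow_n_Cpow.
    specialize (Hmain z Fz HFz); cbv zeta in Hmain; specialize (Hval gz Hgz).
    set (w := Cminus z (RtoC z0)) in *.
    assert (Hw : w <> RtoC 0).
    { intros H; assert (Hz' : z = RtoC z0).
      { replace z with (Cplus w (RtoC z0)) by (unfold w; ring); rewrite H; ring. }
      rewrite Hz', Cmod_R, Rabs_pos_eq in Hzlt; lra. }
    rewrite <- Hval in Hmain.
    replace j with (l + (j - l))%nat in Hmain at 1 by lia; rewrite Cpow_add_r in Hmain.
    assert (Hl : Cpow w l <> RtoC 0) by (apply Cpow_nz; exact Hw).
    assert (Hq := HQq w HzQ).
    set (u := peval (c :: q) w) in *.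
    transitivity (Cmult (Cinv (Cmult (Cpow w l) u))
       (Cmult (Cmult (Cmult (Cpow w l) (Cpow w (j - l))) u) Fz)).
    + field; split; assumption.
    + rewrite Hmain; field; split; assumption.
Qed.

(** * Exponential decay rates *)

Lemma exp_rate_bounds (W : nat -> R) (rho d : R) : (forall m, 0 < W m) ->
  is_lim_seq (fun m => - ln (W m) / INR m) rho -> 0 < d ->
  exists M, forall m, (M <= m)%nat ->
    exp (- (rho + d) * INR m) <= W m <= exp (- (rho - d) * INR m).
Proof.
  intros HW Hlim Hd.
  apply is_lim_seq_spec in Hlim; destruct (Hlim (mkposreal d Hd)) as [M HM]; simpl in HM.
  (* The successor excludes [m = 0], where the quotient by [INR m] carries no information. *)
  exists (S M); intros m Hm; specialize (HM m ltac:(lia)).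
  assert (Hm0 : 0 < INR m) by (apply lt_0_INR; lia).
  set (y := - ln (W m) / INR m) in *.
  assert (E : W m = exp (- y * INR m)).
  { unfold y; replace (- (- ln (W m) / INR m) * INR m) with (ln (W m)) by (field; lra).
    symmetry; apply exp_ln, HW. }
  apply Rabs_def2 in HM; rewrite E.
  split; apply Rlt_le, exp_increasing; nra.
Qed.

(* Fekete's argument: [C * a] is submultiplicative, so one value below [exp (- rho * n)] would
   force a decay rate larger than [rho] along the multiples of [n]. *)
Lemma submultiplicative_lower_bound (a W : nat -> R) (rho C : R) : 0 < C ->
  (forall m, 0 < W m) -> (forall m, W m <= a (S m)) ->
  is_lim_seq (fun m => - ln (W m) / INR m) rho ->
  (forall m n, (1 <= m)%nat -> (1 <= n)%nat -> a (m + n)%nat <= C * a m * a n) ->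
  forall n, (1 <= n)%nat -> / C * (/ exp rho) ^ n <= a n.
Proof.
  intros HC HW HWa Hlim Hsub n Hn.
  assert (Hapos : forall k, (1 <= k)%nat -> 0 < a k).
  { intros [|k] Hk; [lia|generalize (HW k) (HWa k); lra]. }
  destruct (Rle_lt_dec (/ C * (/ exp rho) ^ n) (a n)) as [H|H]; [exact H|exfalso].
  assert (Hn0 : 0 < INR n) by (apply lt_0_INR; lia).
  assert (Han := Hapos n Hn).
  pose (y := ln (C * a n)).
  assert (Ey : exp y = C * a n) by (apply exp_ln, Rmult_lt_0_compat; lra).
  assert (Hpow : (/ exp rho) ^ n = exp (- rho * INR n)).
  { rewrite <- exp_Ropp, <- Rpower_pow by apply exp_pos; unfold Rpower; rewrite ln_exp.
    f_equal; ring. }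
  assert (Hy : y < - rho * INR n).
  { apply exp_lt_inv; rewrite Ey, <- Hpow.
    apply Rmult_lt_reg_l with (/ C); [apply Rinv_0_lt_compat; lra|].
    rewrite <- Rmult_assoc, Rinv_l, Rmult_1_l by lra; exact H. }
  (* The decay rate along multiples of [n] would be at least [rho + 2 * d]. One [d] absorbs the
     error in the limit; the other leaves a factor [exp (d * (s + 1))] that must stay bounded. *)
  pose (d := (- rho * INR n - y) / (2 * INR n)).
  assert (Hd : 0 < d) by (apply Rdiv_lt_0_compat; lra).
  assert (Eyd : y = - (rho + 2 * d) * INR n) by (unfold d; field; lra).
  assert (Hmult : forall k, C * a (S k * n)%nat <= exp (INR (S k) * y)).
  { induction k as [|k IH].
    - rewrite Nat.mul_1_l, Rmult_1_l, Ey; lra.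
    - replace (S (S k) * n)%nat with (n + S k * n)%nat by lia.
      rewrite (S_INR (S k)), Rmult_plus_distr_r, exp_plus, Rmult_1_l, Ey.
      specialize (Hsub n (S k * n)%nat Hn ltac:(nia)).
      assert (0 < C * a n) by (apply Rmult_lt_0_compat; lra).
      apply Rle_trans with (C * (C * a n * a (S k * n)%nat)); [apply Rmult_le_compat_l; lra|].
      replace (C * (C * a n * a (S k * n)%nat)) with (C * a (S k * n)%nat * (C * a n)) by ring.
      apply Rmult_le_compat_r; lra. }
  destruct (exp_rate_bounds W rho d HW Hlim Hd) as [M HM].
  assert (HE : 0 < C * exp (rho + d)) by (apply Rmult_lt_0_compat; [lra|apply exp_pos]).
  destruct (INR_archimed d (/ (C * exp (rho + d))) Hd) as [k Hk].
  pose (m := (M + k)%nat).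
  (* The multiple of [n] is written as a successor because [W s] is compared with [a (S s)]. *)
  assert (Hmn : exists s, (S m * n)%nat = S s /\ (M <= s)%nat) by (exists (S m * n - 1)%nat; nia).
  destruct Hmn as (s & Es & Hs).
  specialize (Hmult m); specialize (HWa s); specialize (HM s Hs).
  rewrite Es in Hmult.
  assert (Hs' : INR (S m) * INR n = INR s + 1) by (rewrite <- mult_INR, Es, S_INR; reflexivity).
  rewrite Eyd in Hmult.
  replace (INR (S m) * (- (rho + 2 * d) * INR n)) with (- (rho + 2 * d) * (INR (S m) * INR n))
    in Hmult by ring.
  rewrite Hs' in Hmult.
  assert (H1 : C * exp (- (rho + d) * INR s) <= exp (- (rho + 2 * d) * (INR s + 1))).
  { eapply Rle_trans; [|exact Hmult]; apply Rmult_le_compat_l; lra. }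
  assert (H2 : C * exp (rho + d) * exp (d * (INR s + 1)) <= 1).
  { apply Rle_trans with (exp (- (rho + 2 * d) * (INR s + 1)) * exp ((rho + 2 * d) * (INR s + 1))).
    2: { rewrite <- exp_plus, <- exp_0; apply Req_le; f_equal; ring. }
    replace (C * exp (rho + d) * exp (d * (INR s + 1))) with
      (C * exp (- (rho + d) * INR s) * exp ((rho + 2 * d) * (INR s + 1))).
    - apply Rmult_le_compat_r; [apply Rlt_le, exp_pos|exact H1].
    - rewrite !Rmult_assoc, <- !exp_plus; f_equal; f_equal; ring. }
  assert (H3 : INR k * d <= d * (INR s + 1)).
  { assert (INR k <= INR s) by (apply le_INR; unfold m in Es; nia). nra. }
  assert (H4 := exp_ineq1_le (d * (INR s + 1))).
  assert (H5 : / (C * exp (rho + d)) < exp (d * (INR s + 1))) by lra.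
  apply Rmult_lt_compat_l with (r := C * exp (rho + d)) in H5; [|exact HE].
  rewrite Rinv_r in H5; lra.
Qed.

Lemma finite_prefix_bounded (f : nat -> R) (K : nat) : exists B, forall n, (n < K)%nat -> f n <= B.
Proof.
  induction K as [|K [B HB]]; [exists 0; intros; lia|].
  exists (Rmax B (f K)); intros n Hn.
  destruct (Nat.eq_dec n K) as [->|]; [apply Rmax_r|].
  eapply Rle_trans; [apply HB; lia|apply Rmax_l].
Qed.

(** The radius is the supremum of the [r] for which [a n * r ^ n] is bounded. Above [exp rho],
    Bernoulli's inequality applied to the lower bound on [a] makes these terms unbounded; below it,
    the decay of [W] bounds them. *)
Lemma CV_radius_exp_rate (a W : nat -> R) (rho c : R) (L : nat) : 0 < c ->
  (forall m, 0 < W m) -> (forall m, a (m + L)%nat <= W m) ->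
  is_lim_seq (fun m => - ln (W m) / INR m) rho ->
  (forall n, (1 <= n)%nat -> c * (/ exp rho) ^ n <= a n) ->
  CV_radius a = Finite (exp rho).
Proof.
  intros Hc HW HaW Hlim Hlow.
  rewrite <- (is_lub_Rbar_unique _ _ (CV_radius_bounded a)).
  apply is_lub_Rbar_unique.
  assert (He := exp_pos rho).
  assert (Hpos : forall n, (1 <= n)%nat -> 0 < a n).
  { intros n Hn; eapply Rlt_le_trans; [|exact (Hlow n Hn)].
    apply Rmult_lt_0_compat; [lra|apply pow_lt, Rinv_0_lt_compat; lra]. }
  split.
  - intros r [B HB]; simpl; apply Rnot_lt_le; intros Hr.
    pose (x := r / exp rho - 1).
    assert (Hx : 0 < x).
    { unfold x; apply Rlt_0_minus, Rmult_lt_reg_r with (exp rho); [lra|].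
      unfold Rdiv; rewrite Rmult_assoc, Rinv_l by lra; lra. }
    destruct (INR_archimed x (B / c) Hx) as [k Hk].
    specialize (HB (S k)); specialize (Hlow (S k) ltac:(lia)).
    assert (Hpoly := poly (S k) x Hx).
    assert (Hrk : 0 < r ^ S k) by (apply pow_lt; lra).
    rewrite Rabs_pos_eq in HB by (generalize (Hpos (S k) ltac:(lia)); nra).
    replace (1 + x) with (r * / exp rho) in Hpoly by (unfold x; field; lra).
    rewrite Rpow_mult_distr in Hpoly.
    assert (H1 : c * (r ^ S k * (/ exp rho) ^ S k) <= B).
    { eapply Rle_trans; [|exact HB].
      replace (c * (r ^ S k * (/ exp rho) ^ S k)) with (c * (/ exp rho) ^ S k * r ^ S k) by ring.
      apply Rmult_le_compat_r; lra. }
    assert (H2 : B / c * c = B) by (field; lra).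
    rewrite S_INR in Hpoly.
    assert (H3 : B / c < r ^ S k * (/ exp rho) ^ S k) by nra.
    nra.
  - intros b Hb.
    assert (Hin : forall r, 0 < r < exp rho -> Rbar_le r b).
    { intros r Hr; apply Hb.
      (* With this [d] the rate [rho - d] is [ln r], so eventually [W m <= / r ^ m] and
         [a (m + L) * r ^ (m + L) <= r ^ L]. *)
      pose (d := rho - ln r).
      assert (Hd : 0 < d).
      { unfold d; assert (ln r < rho); [|lra].
        rewrite <- (ln_exp rho); apply ln_increasing; lra. }
      destruct (exp_rate_bounds W rho d HW Hlim Hd) as [M HM].
      destruct (finite_prefix_bounded (fun n => Rabs (a n * r ^ n)) (S M + L)) as [B HB].
      exists (Rmax B (r ^ L)); intros n.
      destruct (le_lt_dec (S M + L) n) as [Hn|Hn].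
      2: { eapply Rle_trans; [apply HB; exact Hn|apply Rmax_l]. }
      eapply Rle_trans; [|apply Rmax_r].
      assert (En : n = ((n - L) + L)%nat) by lia.
      set (m := (n - L)%nat) in *.
      specialize (HaW m); rewrite <- En in HaW.
      destruct (HM m) as [_ HWm]; [lia|].
      assert (Hrn : 0 < r ^ n) by (apply pow_lt; lra).
      assert (Han := Hpos n ltac:(lia)).
      rewrite Rabs_pos_eq by nra.
      replace (- (rho - d) * INR m) with (- (INR m * ln r)) in HWm by (unfold d; ring).
      rewrite exp_Ropp in HWm; change (exp (INR m * ln r)) with (Rpower r (INR m)) in HWm.
      rewrite Rpower_pow in HWm by lra.
      assert (Hrm : 0 < r ^ m) by (apply pow_lt; lra).
      apply Rle_trans with (/ r ^ m * r ^ n); [apply Rmult_le_compat_r; lra|].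
      rewrite En, pow_add, <- Rmult_assoc, Rinv_l by lra; lra. }
    (* This excludes [b = m_infty] and makes a finite [b] positive, so that the midpoint of [b] and
       [exp rho] is an admissible [r]. *)
    assert (Hhalf : Rbar_le (exp rho / 2) b) by (apply Hin; lra).
    destruct b as [b| |]; simpl in *; [|exact I|exact Hhalf].
    apply Rnot_lt_le; intros Hlt.
    assert (H := Hin ((b + exp rho) / 2)); lra.
Qed.

(** * Finite sums and linear dependence *)

Lemma Rsum_ext {T : Type} (l : list T) (f g : T -> R) :
  (forall x, In x l -> f x = g x) -> Rsum l f = Rsum l g.
Proof.
  induction l as [|x l IH]; intros H; simpl; [reflexivity|].
  f_equal; [apply H; left; reflexivity|apply IH; intros y Hy; apply H; right; exact Hy].
Qed.

Lemma Rsum_le {T : Type} (l : list T) (f g : T -> R) :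
  (forall x, In x l -> f x <= g x) -> Rsum l f <= Rsum l g.
Proof.
  induction l as [|x l IH]; intros H; simpl; [lra|].
  apply Rplus_le_compat; [apply H; left; reflexivity|apply IH; intros y Hy; apply H; right; exact Hy].
Qed.

Lemma Rsum_0 {T : Type} (l : list T) (f : T -> R) :
  (forall x, In x l -> f x = 0) -> Rsum l f = 0.
Proof.
  induction l as [|x l IH]; intros H; simpl; [reflexivity|].
  rewrite (H x (or_introl eq_refl)), IH; [ring|intros y Hy; apply H; right; exact Hy].
Qed.

Lemma Rsum_nonneg {T : Type} (l : list T) (f : T -> R) :
  (forall x, In x l -> 0 <= f x) -> 0 <= Rsum l f.
Proof. intros H; rewrite <- (Rsum_0 l (fun _ => 0)) by reflexivity; apply Rsum_le, H. Qed.

Lemma Rsum_ge_term {T : Type} (l : list T) (f : T -> R) (x : T) :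
  (forall y, In y l -> 0 <= f y) -> In x l -> f x <= Rsum l f.
Proof.
  induction l as [|y l IH]; intros H Hx; [destruct Hx|simpl].
  assert (Hl : forall z, In z l -> 0 <= f z) by (intros z Hz; apply H; right; exact Hz).
  assert (Hy := H y (or_introl eq_refl)).
  destruct Hx as [->|Hx]; [generalize (Rsum_nonneg l f Hl)|generalize (IH Hl Hx)]; lra.
Qed.

Lemma Rsum_pos_ex {T : Type} (l : list T) (f : T -> R) :
  0 < Rsum l f -> exists x, In x l /\ 0 < f x.
Proof.
  induction l as [|x l IH]; simpl; intros H; [lra|].
  destruct (Rlt_dec 0 (f x)) as [Hx|Hx]; [exists x; tauto|].
  destruct IH as [y [Hy Hfy]]; [lra|exists y; tauto].
Qed.

Lemma Rsum_plus {T : Type} (l : list T) (f g : T -> R) :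
  Rsum l (fun x => f x + g x) = Rsum l f + Rsum l g.
Proof. induction l as [|x l IH]; simpl; [ring|rewrite IH; ring]. Qed.

Lemma Rsum_scal_l {T : Type} (c : R) (l : list T) (f : T -> R) :
  Rsum l (fun x => c * f x) = c * Rsum l f.
Proof. induction l as [|x l IH]; simpl; [ring|rewrite IH; ring]. Qed.

Lemma Rsum_scal_r {T : Type} (c : R) (l : list T) (f : T -> R) :
  Rsum l (fun x => f x * c) = Rsum l f * c.
Proof. induction l as [|x l IH]; simpl; [ring|rewrite IH; ring]. Qed.

Lemma Rsum_app {T : Type} (l l' : list T) (f : T -> R) :
  Rsum (l ++ l') f = Rsum l f + Rsum l' f.
Proof. induction l as [|x l IH]; simpl; [ring|rewrite IH; ring]. Qed.

Lemma Rsum_map {S T : Type} (h : S -> T) (l : list S) (f : T -> R) :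
  Rsum (map h l) f = Rsum l (fun x => f (h x)).
Proof. induction l as [|x l IH]; simpl; [reflexivity|rewrite IH; reflexivity]. Qed.

Lemma Rsum_flat_map {S T : Type} (h : S -> list T) (l : list S) (f : T -> R) :
  Rsum (flat_map h l) f = Rsum l (fun x => Rsum (h x) f).
Proof. induction l as [|x l IH]; simpl; [reflexivity|rewrite Rsum_app, IH; reflexivity]. Qed.

Lemma Rsum_swap {S T : Type} (l : list S) (l' : list T) (f : S -> T -> R) :
  Rsum l (fun x => Rsum l' (fun y => f x y)) = Rsum l' (fun y => Rsum l (fun x => f x y)).
Proof.
  induction l as [|x l IH]; simpl.
  - symmetry; apply Rsum_0; reflexivity.
  - rewrite Rsum_plus, IH; reflexivity.
Qed.

Lemma Rsum_perm {T : Type} (l l' : list T) (f : T -> R) :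
  Permutation l l' -> Rsum l f = Rsum l' f.
Proof. induction 1; simpl; lra. Qed.

Lemma Rsum_single (N k : nat) (f : nat -> R) : (k < N)%nat ->
  (forall i, (i < N)%nat -> i <> k -> f i = 0) -> Rsum (seq 0 N) f = f k.
Proof.
  intros Hk H.
  destruct (in_split k (seq 0 N)) as (l1 & l2 & E); [apply in_seq; lia|].
  assert (Hnd := seq_NoDup N 0); rewrite E in Hnd.
  apply NoDup_remove_2 in Hnd.
  assert (Hin : forall i, In i (l1 ++ l2) -> f i = 0).
  { intros i Hi; apply H; [|intros ->; tauto].
    assert (Hs : In i (seq 0 N)) by (rewrite E; apply in_app_iff in Hi; apply in_app_iff; simpl; tauto).
    apply in_seq in Hs; lia. }
  rewrite E, (Rsum_perm _ (k :: l1 ++ l2)) by (symmetry; apply Permutation_middle).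
  simpl; rewrite Rsum_0 by exact Hin; ring.
Qed.

(** Gaussian elimination, one coordinate [t] at a time. A vector [j] with nonzero entry at [t] is
    the pivot subtracted from the others; if there is none, the coordinate is void and one vector is
    dropped with coefficient 0. *)
Lemma linear_dependence {T : Type} (l : list T) : forall (idx : list nat) (f : nat -> T -> R),
  NoDup idx -> (length l < length idx)%nat ->
  exists c : nat -> R, (exists i, In i idx /\ c i <> 0) /\
    forall t, In t l -> Rsum idx (fun i => c i * f i t) = 0.
Proof.
  induction l as [|t l IH]; intros idx f Hnd Hlen.
  - destruct idx as [|i idx]; [simpl in Hlen; lia|].
    exists (fun _ => 1); split; [exists i; split; [left; reflexivity|lra]|intros t []].
  - destruct (Classical_Prop.classic (exists j, In j idx /\ f j t <> 0)) as [[j [Hj Hjt]]|Hno].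
    + apply in_split in Hj; destruct Hj as (l1 & l2 & E).
      assert (Hperm : Permutation idx (j :: l1 ++ l2))
        by (rewrite E; symmetry; apply Permutation_middle).
      rewrite E in Hnd; assert (Hnj := NoDup_remove_2 _ _ _ Hnd); apply NoDup_remove_1 in Hnd.
      set (idx' := l1 ++ l2) in *.
      destruct (IH idx' (fun i s => f i s - f i t / f j t * f j s) Hnd) as (c & (i & Hi & Hci) & Hc).
      { apply Permutation_length in Hperm; simpl in Hperm, Hlen; lia. }
      (* The pivot's coefficient collects the multiples of [f j] subtracted from the other
         vectors. *)
      pose (cj := - Rsum idx' (fun k => c k * f k t / f j t)).
      exists (fun k => if Nat.eq_dec k j then cj else c k); split.
      * exists i; split; [apply (Permutation_in _ (Permutation_sym Hperm)); right; exact Hi|].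
        destruct (Nat.eq_dec i j) as [->|]; [contradiction|exact Hci].
      * intros s Hs; rewrite (Rsum_perm _ _ _ Hperm); simpl.
        destruct (Nat.eq_dec j j) as [_|]; [|congruence].
        rewrite (Rsum_ext idx' _ (fun k => c k * f k s)).
        2: { intros k Hk; destruct (Nat.eq_dec k j) as [->|]; [contradiction|reflexivity]. }
        transitivity (Rsum idx' (fun k => c k * (f k s - f k t / f j t * f j s))).
        -- unfold cj; rewrite Ropp_mult_distr_l_reverse, <- Rsum_scal_r.
           rewrite (Rsum_ext idx' (fun k => c k * (f k s - f k t / f j t * f j s))
                      (fun k => c k * f k s + (-1) * (c k * f k t / f j t * f j s)))
             by (intros; unfold Rdiv; ring).
           rewrite Rsum_plus, Rsum_scal_l; ring.
        -- destruct Hs as [<-|Hs]; [|exact (Hc s Hs)].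
           apply Rsum_0; intros k _; field; exact Hjt.
    + destruct idx as [|i idx]; [simpl in Hlen; lia|].
      inversion_clear Hnd.
      destruct (IH idx f) as (c & (k & Hk & Hck) & Hc); [assumption|simpl in Hlen; lia|].
      exists (fun m => if Nat.eq_dec m i then 0 else c m); split.
      * exists k; split; [right; exact Hk|].
        destruct (Nat.eq_dec k i) as [->|]; [contradiction|exact Hck].
      * intros s [<-|Hs].
        -- apply Rsum_0; intros m Hm.
           replace (f m t) with 0; [ring|].
           symmetry; apply Classical_Prop.NNPP; intros Hne; apply Hno; exists m; tauto.
        -- etransitivity; [|exact (Hc s Hs)]; simpl.
           destruct (Nat.eq_dec i i) as [_|]; [|congruence].
           rewrite Rmult_0_l, Rplus_0_l; apply Rsum_ext; intros m Hm.
           destruct (Nat.eq_dec m i) as [->|]; [contradiction|reflexivity].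
Qed.

(** The bound on [m] keeps every [n - k] a genuine difference, never truncated at 0. *)
Lemma pmul_RtoC (a : nat -> R) (m : nat) : forall (c : nat -> R) (n : nat), (m <= S n)%nat ->
  pmul (map (fun k => RtoC (c k)) (seq 0 m)) (fun k => RtoC (a k)) n =
  RtoC (Rsum (seq 0 m) (fun k => c k * a (n - k)%nat)).
Proof.
  induction m as [|m IH]; intros c n Hn; [reflexivity|].
  cbn [seq map pmul]; unfold Rsum; cbn [fold_right]; fold (@Rsum nat).
  rewrite <- seq_shift, map_map.
  change (fold_right (fun x acc => c x * a (n - x)%nat + acc) 0 (map S (seq 0 m)))
    with (Rsum (map S (seq 0 m)) (fun x => c x * a (n - x)%nat)).
  rewrite Rsum_map, RtoC_plus, RtoC_mult, Nat.sub_0_r; f_equal.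
  destruct n as [|n].
  - replace m with 0%nat by lia; reflexivity.
  - apply (IH (fun k => c (S k)) n); lia.
Qed.

(** * Words and cylinders *)

Lemma ind_true (Q : Prop) : Q -> ind Q = 1.
Proof. intros H; unfold ind; destruct (excluded_middle_informative Q); tauto. Qed.

Lemma ind_false (Q : Prop) : ~ Q -> ind Q = 0.
Proof. intros H; unfold ind; destruct (excluded_middle_informative Q); tauto. Qed.

Lemma ind_bounds (Q : Prop) : 0 <= ind Q <= 1.
Proof. unfold ind; destruct (excluded_middle_informative Q); lra. Qed.

Lemma ind_le (Q Q' : Prop) : (Q -> Q') -> ind Q <= ind Q'.
Proof.
  intros H; destruct (Classical_Prop.classic Q) as [HQ|HQ].
  - rewrite !ind_true by auto; lra.
  - rewrite (ind_false Q HQ); apply ind_bounds.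
Qed.

Lemma ind_and (Q Q' : Prop) : ind (Q /\ Q') = ind Q * ind Q'.
Proof.
  destruct (Classical_Prop.classic Q) as [HQ|HQ];
    [|rewrite (ind_false Q HQ), ind_false by tauto; ring].
  destruct (Classical_Prop.classic Q') as [HQ'|HQ'].
  - rewrite !ind_true by tauto; ring.
  - rewrite (ind_false Q' HQ'), ind_false by tauto; ring.
Qed.

Lemma ind_iff (Q Q' : Prop) : (Q <-> Q') -> ind Q = ind Q'.
Proof. intros [H H']; apply Rle_antisym; apply ind_le; assumption. Qed.

Lemma in_words (N n : nat) : forall w,
  In w (words N n) <-> length w = n /\ List.Forall (fun a => (a < N)%nat) w.
Proof.
  induction n as [|n IH]; intros w; simpl.
  - split; [intros [<-|[]]; auto|].
    intros [H _]; left; symmetry; apply length_zero_iff_nil, H.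
  - rewrite in_flat_map; split.
    + intros (a & Ha & Hw); apply in_map_iff in Hw; destruct Hw as (v & <- & Hv).
      apply IH in Hv; destruct Hv as [Hv1 Hv2]; apply in_seq in Ha.
      split; [simpl; lia|constructor; [lia|exact Hv2]].
    + intros [Hl HF]; destruct w as [|a v]; [discriminate|].
      inversion_clear HF; exists a; split; [apply in_seq; lia|].
      apply in_map, IH; split; [simpl in Hl; lia|assumption].
Qed.

Lemma Rsum_words_S (N n : nat) (f : list nat -> R) :
  Rsum (words N (S n)) f = Rsum (seq 0 N) (fun a => Rsum (words N n) (fun v => f (a :: v))).
Proof.
  cbn [words]; rewrite Rsum_flat_map; apply Rsum_ext; intros a _; apply Rsum_map.
Qed.

Lemma Rsum_words_add (N m n : nat) : forall f : list nat -> R,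
  Rsum (words N (m + n)) f = Rsum (words N m) (fun u => Rsum (words N n) (fun v => f (u ++ v))).
Proof.
  induction m as [|m IH]; intros f.
  - simpl; rewrite Rplus_0_r; reflexivity.
  - cbn [Nat.add]; rewrite !Rsum_words_S; apply Rsum_ext; intros a _; rewrite IH; reflexivity.
Qed.

Lemma last_cons (u : list nat) : forall a b, last (b :: u) a = last u b.
Proof.
  induction u as [|c u IH]; intros a b; [reflexivity|].
  change (last (b :: c :: u) a) with (last (c :: u) a); rewrite !IH; reflexivity.
Qed.

Lemma trans_app (P : nat -> nat -> R) (u v : list nat) : forall a,
  trans P a (u ++ v) = trans P a u * trans P (last u a) v.
Proof.
  induction u as [|b u IH]; intros a; [simpl; ring|].
  rewrite last_cons; simpl; rewrite IH; ring.
Qed.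

Lemma subword_app_l (g u v : list nat) : subword g u -> subword g (u ++ v).
Proof. intros (a & b & ->); exists a, (b ++ v); rewrite <- !app_assoc; reflexivity. Qed.

Lemma subword_app_r (g u v : list nat) : subword g v -> subword g (u ++ v).
Proof. intros (a & b & ->); exists (u ++ a), b; rewrite <- !app_assoc; reflexivity. Qed.

Lemma subword_cons (g : list nat) (c : nat) (w : list nat) :
  subword g (c :: w) <-> subword g w \/ exists b, c :: w = g ++ b.
Proof.
  split.
  - intros ([|a0 a] & b & E); [right; exists b; exact E|left].
    injection E as _ ->; exists a, b; reflexivity.
  - intros [(a & b & ->)|(b & E)]; [exists (c :: a), b|exists nil, b]; [reflexivity|exact E].
Qed.

Lemma begins_with_subword (x : nat -> nat) (w g : list nat) (i : nat) :
  begins_with w x -> begins_with g (shift i x) -> (i + length g <= length w)%nat -> subword g w.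
Proof.
  intros Hw Hg Hl; exists (firstn i w), (skipn (length g) (skipn i w)).
  assert (E : firstn (length g) (skipn i w) = g).
  { apply nth_ext with 0%nat 0%nat.
    - rewrite length_firstn, length_skipn; lia.
    - intros n Hn; rewrite length_firstn, length_skipn in Hn.
      rewrite nth_firstn, nth_skipn.
      replace (n <? length g) with true by (symmetry; apply Nat.ltb_lt; lia).
      rewrite <- Hw, <- Hg by lia; reflexivity. }
  rewrite <- E at 1; rewrite !firstn_skipn; reflexivity.
Qed.

Lemma begins_with_shift_subword (x : nat -> nat) (a g b : list nat) :
  begins_with (a ++ g ++ b) x -> begins_with g (shift (length a) x).
Proof.
  intros H t Ht; unfold shift; rewrite H by (rewrite !length_app; lia).
  rewrite app_nth2_plus, app_nth1 by lia; reflexivity.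
Qed.

Lemma allowed_cyl (N : nat) (A : nat -> nat -> bool) (w : list nat) :
  allowed N A w -> exists x, cyl N A w x.
Proof.
  intros (x & Hx & k & Hk); exists (shift k x); split; [|exact Hk].
  intros n; unfold shift; replace (k + S n)%nat with (S (k + n)) by lia; apply Hx.
Qed.

Lemma length_le_maxlen (G : list (list nat)) (g : list nat) :
  In g G -> (length g <= maxlen G)%nat.
Proof.
  unfold maxlen; induction G as [|h G IH]; [intros []|simpl].
  intros [->|H]; [lia|specialize (IH H); lia].
Qed.

(** * Words avoiding [G] under a Markov measure *)

Section MarkovShift.

Variables (N : nat) (A : nat -> nat -> bool) (P : nat -> nat -> R) (p : nat -> R).
Variable G : list (list nat).
Hypothesis hA : irreducible N A.
Hypothesis hP0 : forall i j, (i < N)%nat -> (j < N)%nat -> 0 <= P i j.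
Hypothesis hPA : forall i j, (i < N)%nat -> (j < N)%nat -> (0 < P i j <-> A i j = true).
Hypothesis hProw : forall i, (i < N)%nat -> Rsum (seq 0 N) (fun j => P i j) = 1.
Hypothesis hp0 : forall i, (i < N)%nat -> 0 <= p i.
Hypothesis hp1 : Rsum (seq 0 N) p = 1.
Hypothesis hpstat : forall j, (j < N)%nat -> Rsum (seq 0 N) (fun i => p i * P i j) = p j.
Hypothesis hGnil : ~ In nil G.

Definition avoids (w : list nat) : Prop := forall g, In g G -> ~ subword g w.

(** The sum runs over all words, so it splits under concatenation; for [n >= 1] the words that are
    not allowed contribute 0. *)
Definition avoid_mass (n : nat) : R := Rsum (words N n) (fun w => ind (avoids w) * mu_cyl p P w).

Lemma stochastic_le_1 (i j : nat) : (i < N)%nat -> (j < N)%nat -> P i j <= 1.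
Proof.
  intros Hi Hj; rewrite <- (hProw i Hi).
  apply (Rsum_ge_term (seq 0 N) (fun j => P i j)).
  - intros k Hk; apply in_seq in Hk; apply hP0; lia.
  - apply in_seq; lia.
Qed.

(** Positivity travels along edges, since [p b >= p a * P a b]. Some entry is positive because the
    total is 1, and irreducibility leads from it to every state. *)
Lemma stationary_pos (i : nat) : (i < N)%nat -> 0 < p i.
Proof.
  intros Hi.
  destruct (Rsum_pos_ex (seq 0 N) p) as [k [Hk Hpk]]; [rewrite hp1; lra|].
  apply in_seq in Hk.
  assert (H := hA k i ltac:(lia) Hi); clear Hi Hk; revert Hpk.
  induction H as [a b [Ha [Hb Hab]]|a b c _ IH1 _ IH2]; intros Hpa.
  - rewrite <- hpstat by exact Hb.
    apply Rlt_le_trans with (p a * P a b).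
    + apply Rmult_lt_0_compat; [exact Hpa|apply hPA; assumption].
    + apply (Rsum_ge_term (seq 0 N) (fun i => p i * P i b)); [|apply in_seq; lia].
      intros y Hy; apply in_seq in Hy; apply Rmult_le_pos; [apply hp0|apply hP0]; lia.
  - apply IH2, IH1, Hpa.
Qed.

Lemma stationary_lower_bound : exists c, 0 < c /\ forall i, (i < N)%nat -> c <= p i.
Proof.
  assert (H := stationary_pos); clear - H; induction N as [|n IH].
  - exists 1; split; [lra|intros; lia].
  - destruct IH as [c [Hc Hle]]; [intros i Hi; apply H; lia|].
    exists (Rmin c (p n)); split; [apply Rmin_pos; [exact Hc|apply H; lia]|].
    intros i Hi; destruct (Nat.eq_dec i n) as [->|]; [apply Rmin_r|].
    eapply Rle_trans; [apply Rmin_l|apply Hle; lia].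
Qed.

Lemma trans_nonneg (r : list nat) : forall a, (a < N)%nat ->
  List.Forall (fun b => (b < N)%nat) r -> 0 <= trans P a r.
Proof.
  induction r as [|b r IH]; intros a Ha Hr; simpl; [lra|]; inversion_clear Hr.
  apply Rmult_le_pos; [apply hP0|apply IH]; assumption.
Qed.

Lemma mu_cyl_nonneg (n : nat) (w : list nat) : In w (words N n) -> 0 <= mu_cyl p P w.
Proof.
  intros Hw; apply in_words in Hw; destruct Hw as [_ Hw].
  destruct w as [|a r]; simpl; [lra|]; inversion_clear Hw.
  apply Rmult_le_pos; [apply hp0|apply trans_nonneg]; assumption.
Qed.

Lemma Rsum_trans (n : nat) : forall a, (a < N)%nat -> Rsum (words N n) (trans P a) = 1.
Proof.
  induction n as [|n IH]; intros a Ha; [simpl; ring|].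
  rewrite Rsum_words_S, <- (hProw a Ha); apply Rsum_ext; intros b Hb; apply in_seq in Hb.
  cbn [trans]; rewrite Rsum_scal_l, IH by lia; ring.
Qed.

Lemma mu_cyl_app (u v : list nat) : u <> nil ->
  mu_cyl p P (u ++ v) = mu_cyl p P u * trans P (last u 0%nat) v.
Proof.
  destruct u as [|a u]; [congruence|intros _]; rewrite last_cons; simpl.
  rewrite trans_app; ring.
Qed.

Lemma last_lt (u : list nat) : forall a, (a < N)%nat ->
  List.Forall (fun b => (b < N)%nat) u -> (last u a < N)%nat.
Proof.
  induction u as [|b u IH]; intros a Ha Hu; [exact Ha|].
  inversion_clear Hu; rewrite last_cons; apply IH; assumption.
Qed.

Lemma path_cyl (r : list nat) : forall a, (a < N)%nat ->
  List.Forall (fun b => (b < N)%nat) r -> trans P a r <> 0 -> exists x, cyl N A (a :: r) x.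
Proof.
  induction r as [|b r IH]; intros a Ha Hr Ht.
  (* Rows of sum 1 leave no dead end, so iterating a choice of successor gives an infinite path; the
     default is never reached from a state below [N]. *)
  - pose (next := fun i => match find (fun j => A i j) (seq 0 N) with Some j => j | None => 0%nat end).
    assert (Hnext : forall i, (i < N)%nat -> (next i < N)%nat /\ A i (next i) = true).
    { intros i Hi; unfold next; destruct (find (fun j => A i j) (seq 0 N)) as [j|] eqn:E.
      - apply find_some in E; destruct E as [Hj Hij]; apply in_seq in Hj; split; [lia|exact Hij].
      - destruct (Rsum_pos_ex (seq 0 N) (fun j => P i j)) as [j [Hj Hij]];
          [rewrite hProw by exact Hi; lra|].
        assert (Hf := find_none _ _ E j Hj); simpl in Hf; apply in_seq in Hj.
        apply hPA in Hij; [congruence|lia|lia]. }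
    exists (fun n => Nat.iter n next a); split.
    + assert (Hlt : forall n, (Nat.iter n next a < N)%nat)
        by (induction n as [|n IHn]; [exact Ha|apply Hnext, IHn]).
      intros n; split; [apply Hlt|apply (Hnext _ (Hlt n))].
    + intros [|t] Hlt; [reflexivity|simpl in Hlt; lia].
  - inversion_clear Hr; simpl in Ht.
    destruct (IH b) as [x [Hx Hbx]]; [assumption|assumption|intros E; apply Ht; rewrite E; ring|].
    assert (Hab : A a b = true).
    { apply hPA; [assumption|assumption|].
      destruct (hP0 a b) as [Hlt|Heq]; [assumption|assumption|exact Hlt|].
      exfalso; apply Ht; rewrite <- Heq; ring. }
    assert (Hx0 : x 0%nat = b) by (apply (Hbx 0%nat); simpl; lia).
    exists (fun n => match n with O => a | S m => x m end); split.
    + intros [|n]; [|apply Hx].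
      rewrite Hx0; split; assumption.
    + intros [|t] Hlt; [reflexivity|]; apply (Hbx t); simpl in Hlt |- *; lia.
Qed.

Lemma allowed_of_mu_cyl (n : nat) (w : list nat) :
  In w (words N (S n)) -> mu_cyl p P w <> 0 -> allowed N A w.
Proof.
  intros Hw Hmu; apply in_words in Hw; destruct Hw as [Hl HF].
  destruct w as [|a r]; [discriminate|]; inversion_clear HF.
  destruct (path_cyl r a) as [x [Hx Hb]]; [assumption|assumption| |].
  - intros E; apply Hmu; simpl; rewrite E; ring.
  - exists x; split; [exact Hx|exists 0%nat; exact Hb].
Qed.

(** A nonempty word has exactly one last letter [i], so the sum over [i] collapses; if the word
    avoids [G], then [[i]], being a subword, is not in [G]. *)
Lemma Fcoef_avoid_mass (n : nat) : Fcoef N A p P G (S n) = avoid_mass (S n).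
Proof.
  unfold avoid_mass, Fcoef, mu_ni.
  transitivity (Rsum (seq 0 N) (fun i => Rsum (words N (S n)) (fun w =>
    ind (~ In [i] G) * (ind (allowed N A w /\ (exists u, w = u ++ [i]) /\
                   forall g, In g G -> ~ subword g w) * mu_cyl p P w)))).
  { apply Rsum_ext; intros i _; symmetry; apply Rsum_scal_l. }
  rewrite Rsum_swap; apply Rsum_ext; intros w Hw.
  assert (Hw' := Hw); apply in_words in Hw; destruct Hw as [Hl HF].
  destruct (exists_last (l := w)) as (u & k & ->); [intros ->; discriminate|].
  apply Forall_app in HF; destruct HF as [_ Hk]; inversion_clear Hk.
  rewrite (Rsum_single N k); [|assumption|].
  - destruct (Req_dec (mu_cyl p P (u ++ [k])) 0) as [->|Hmu]; [ring|].
    rewrite <- Rmult_assoc, <- ind_and; f_equal; apply ind_iff.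
    assert (Hal := allowed_of_mu_cyl n _ Hw' Hmu).
    split; [tauto|]; intros Hav; split.
    + intros Hin; apply (Hav _ Hin); exists u, nil; reflexivity.
    + split; [exact Hal|split; [exists u; reflexivity|exact Hav]].
  - intros i _ Hik; rewrite (ind_false (allowed _ _ _ /\ _)); [ring|].
    intros (_ & (v & E) & _); apply app_inj_tail in E; destruct E; congruence.
Qed.

(** A word of [G] starting at a position [i <= m] ends within the first [m + maxlen G] letters. *)
Lemma avoid_mass_le_mu_W (m : nat) : (1 <= m + maxlen G)%nat ->
  avoid_mass (m + maxlen G) <= mu_W N A p P G m.
Proof.
  intros Hpos; unfold avoid_mass, mu_W, mu_fin; apply Rsum_le; intros w Hw.
  destruct (Req_dec (mu_cyl p P w) 0) as [->|Hmu]; [lra|].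
  apply Rmult_le_compat_r; [apply (mu_cyl_nonneg _ _ Hw)|].
  apply ind_le; intros Hav; split.
  - replace (m + maxlen G)%nat with (S (m + maxlen G - 1)) in Hw by lia.
    apply (allowed_of_mu_cyl _ _ Hw Hmu).
  - intros x [Hx Hb]; split; [exact Hx|].
    intros i Hi (g & Hg & _ & Hbg); apply (Hav g Hg).
    apply begins_with_subword with x i; [exact Hb|exact Hbg|].
    apply in_words in Hw; destruct Hw as [-> _].
    generalize (length_le_maxlen G g Hg); lia.
Qed.

(** A nonempty word inside the first [m + 1] letters starts at a position at most [m], so on a
    cylinder contained in the set these letters avoid [G]. The remaining [maxlen G - 1] letters are
    left free, with total conditional mass 1. *)
Lemma mu_W_le_avoid_mass (m : nat) : (1 <= maxlen G)%nat ->
  mu_W N A p P G m <= avoid_mass (S m).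
Proof.
  intros HL; unfold mu_W, mu_fin, avoid_mass.
  replace (m + maxlen G)%nat with (S m + (maxlen G - 1))%nat by lia.
  rewrite Rsum_words_add; apply Rsum_le; intros u Hu.
  assert (Hu' := Hu); apply in_words in Hu'; destruct Hu' as [Hul HuF].
  assert (Hune : u <> nil) by (intros ->; discriminate).
  assert (Hmu := mu_cyl_nonneg _ _ Hu).
  apply Rle_trans with (Rsum (words N (maxlen G - 1)) (fun v =>
     ind (avoids u) * mu_cyl p P u * trans P (last u 0%nat) v)).
  - apply Rsum_le; intros v Hv; apply in_words in Hv; destruct Hv as [_ HvF].
    rewrite mu_cyl_app, <- Rmult_assoc by exact Hune.
    assert (Ht : 0 <= trans P (last u 0%nat) v).
    { apply trans_nonneg; [|exact HvF].
      destruct u as [|a u]; [congruence|]; inversion_clear HuF.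
      rewrite last_cons; apply last_lt; assumption. }
    apply Rmult_le_compat_r; [exact Ht|]; apply Rmult_le_compat_r; [exact Hmu|].
    apply ind_le; intros [Hal Hsub] g Hg (a & b & E).
    destruct (allowed_cyl N A _ Hal) as [x Hx].
    destruct (Hsub x Hx) as [_ HW]; destruct Hx as [Hx Hb].
    assert (Hgpos : (0 < length g)%nat) by (destruct g; [contradiction|simpl; lia]).
    apply (HW (length a)); [rewrite E, !length_app in Hul; lia|].
    exists g; split; [exact Hg|split].
    + intros n; unfold shift; replace (length a + S n)%nat with (S (length a + n)) by lia; apply Hx.
    + rewrite E, <- !app_assoc in Hb; apply begins_with_shift_subword in Hb; exact Hb.
  - rewrite Rsum_scal_l, Rsum_trans; [lra|].
    destruct u as [|a u]; [congruence|]; inversion_clear HuF.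
    rewrite last_cons; apply last_lt; assumption.
Qed.

(** Both halves of an avoiding word avoid [G], and the transition probability at the junction is at
    most [1 <= / c * p b], where [b] starts the second half. *)
Lemma avoid_mass_submult (c : R) (m n : nat) : 0 < c -> (forall i, (i < N)%nat -> c <= p i) ->
  (1 <= m)%nat -> (1 <= n)%nat ->
  avoid_mass (m + n) <= / c * avoid_mass m * avoid_mass n.
Proof.
  intros Hc Hcp Hm Hn; unfold avoid_mass at 1 2.
  rewrite Rsum_words_add, <- Rsum_scal_l, <- Rsum_scal_r.
  apply Rsum_le; intros u Hu; unfold avoid_mass; rewrite <- Rsum_scal_l.
  apply Rsum_le; intros v Hv.
  assert (Hmu := mu_cyl_nonneg _ _ Hu).
  apply in_words in Hu; destruct Hu as [Hul HuF].
  apply in_words in Hv; destruct Hv as [Hvl HvF].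
  destruct u as [|a u]; [simpl in Hul; lia|]; destruct v as [|b v]; [simpl in Hvl; lia|].
  inversion_clear HuF; inversion_clear HvF.
  rewrite mu_cyl_app by discriminate; rewrite last_cons.
  set (mu_u := mu_cyl p P (a :: u)) in *; clearbody mu_u; cbn [trans mu_cyl].
  assert (Hl : (last u a < N)%nat) by (apply last_lt; assumption).
  assert (Ht : 0 <= trans P b v) by (apply trans_nonneg; assumption).
  assert (Hind : ind (avoids ((a :: u) ++ b :: v)) <= ind (avoids (a :: u)) * ind (avoids (b :: v))).
  { rewrite <- ind_and; apply ind_le; intros Hav; split; intros g Hg Hs; apply (Hav g Hg).
    - apply subword_app_l, Hs.
    - apply subword_app_r, Hs. }
  assert (HP := hP0 _ b Hl ltac:(assumption)).
  assert (HP1 := stochastic_le_1 _ b Hl ltac:(assumption)).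
  assert (Hb : 1 <= / c * p b).
  { rewrite <- (Rinv_l c) by lra; apply Rmult_le_compat_l;
      [apply Rlt_le, Rinv_0_lt_compat; lra|apply Hcp; assumption]. }
  replace (/ c * (ind (avoids (a :: u)) * mu_u) * (ind (avoids (b :: v)) * (p b * trans P b v)))
    with (ind (avoids (a :: u)) * ind (avoids (b :: v)) * (mu_u * ((/ c * p b) * trans P b v))) by ring.
  apply Rmult_le_compat; [apply ind_bounds| |exact Hind|].
  - repeat apply Rmult_le_pos; assumption.
  - apply Rmult_le_compat_l; [exact Hmu|]; apply Rmult_le_compat_r; lra.
Qed.

(** * Linear recurrence for the avoiding masses *)

(* For [s] of length [maxlen G] this evolves linearly in [n], since whether a word of [G] occurs at
   the first letter depends on [s] only. *)
Definition ext_mass (n : nat) (s : list nat) : R :=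
  Rsum (words N n) (fun r => ind (avoids (s ++ r)) * trans P (hd 0%nat s) (tl s ++ r)).

(** The window [s] slides by one letter. An occurrence at its first letter fits inside [s], which is
    as long as any word of [G]; every other occurrence lies in the word without that letter. *)
Lemma ext_mass_S (n : nat) (s : list nat) : length s = maxlen G -> s <> nil ->
  ext_mass (S n) s = Rsum (seq 0 N) (fun b =>
    ind (forall g, In g G -> ~ exists t, s = g ++ t) * P (hd 0%nat s) (hd 0%nat (tl s ++ [b])) *
    ext_mass n (tl s ++ [b])).
Proof.
  intros Hs Hne; destruct s as [|c s]; [congruence|]; clear Hne.
  unfold ext_mass at 1; rewrite Rsum_words_S; apply Rsum_ext; intros b _.
  unfold ext_mass; rewrite <- Rsum_scal_l; apply Rsum_ext; intros r _; cbn [hd tl].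
  (* [hd 0 (s ++ [b])] is the second letter of the whole word; it is [b] itself when the window has
     length 1. *)
  assert (Ht : trans P c (s ++ b :: r) =
     P c (hd 0%nat (s ++ [b])) * trans P (hd 0%nat (s ++ [b])) (tl (s ++ [b]) ++ r)).
  { destruct s as [|d s]; simpl; [reflexivity|]; rewrite <- app_assoc; reflexivity. }
  rewrite Ht, <- app_assoc; cbn [app].
  rewrite (ind_iff (avoids (c :: s ++ b :: r))
     ((forall g, In g G -> ~ exists t, c :: s = g ++ t) /\ avoids (s ++ b :: r))).
  - rewrite ind_and; ring.
  - split.
    + intros Hav; split.
      * intros g Hg [t E]; apply (Hav g Hg), subword_cons; right.
        exists (t ++ b :: r); rewrite app_assoc, <- E; reflexivity.
      * intros g Hg Hsub; apply (Hav g Hg), subword_cons; left; exact Hsub.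
    + intros [Hpre Hav] g Hg Hsub; apply subword_cons in Hsub.
      destruct Hsub as [Hsub|[t E]]; [exact (Hav g Hg Hsub)|].
      apply (Hpre g Hg); exists (skipn (length g) (c :: s)).
      assert (Hlg := length_le_maxlen G g Hg); rewrite <- Hs in Hlg.
      rewrite <- (firstn_skipn (length g) (c :: s)) at 1; f_equal.
      apply (f_equal (firstn (length g))) in E.
      rewrite firstn_app, Nat.sub_diag, firstn_O, app_nil_r, firstn_all in E.
      etransitivity; [|exact E]; change (c :: s ++ b :: r) with ((c :: s) ++ b :: r).
      rewrite firstn_app; replace (length g - length (c :: s))%nat with 0%nat by lia.
      rewrite firstn_O, app_nil_r; reflexivity.
Qed.

Lemma avoid_mass_ext_mass (n : nat) : (1 <= maxlen G)%nat ->
  avoid_mass (maxlen G + n) = Rsum (words N (maxlen G)) (fun s => p (hd 0%nat s) * ext_mass n s).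
Proof.
  intros HL; unfold avoid_mass; rewrite Rsum_words_add; apply Rsum_ext; intros s Hs.
  unfold ext_mass; rewrite <- Rsum_scal_l; apply Rsum_ext; intros r _.
  apply in_words in Hs; destruct Hs as [Hs _].
  destruct s as [|a s]; [simpl in Hs; lia|simpl; ring].
Qed.

(** More vectors than coordinates are dependent, and a relation among the vectors at times [0] to
    [D] is carried to all later times by the time-independent linear evolution. *)
Lemma avoid_mass_recurrence : (1 <= maxlen G)%nat ->
  exists (D : nat) (c : nat -> R), (exists i, (i <= D)%nat /\ c i <> 0) /\
    forall n, (maxlen G + D <= n)%nat ->
      Rsum (seq 0 (S D)) (fun k => c k * avoid_mass (n - k)) = 0.
Proof.
  intros HL; set (L := maxlen G) in *.
  pose (D := length (words N L)).
  (* The times are reversed so that [c k] multiplies the mass at [n - k], the shape of a Cauchy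
     product coefficient. *)
  destruct (linear_dependence (words N L) (seq 0 (S D)) (fun k => ext_mass (D - k)))
    as (c & (i & Hi & Hci) & Hdep); [apply seq_NoDup|rewrite length_seq; unfold D; lia|].
  apply in_seq in Hi.
  exists D, c; split; [exists i; split; [lia|exact Hci]|].
  assert (Hn : forall n s, In s (words N L) ->
     Rsum (seq 0 (S D)) (fun k => c k * ext_mass (n + (D - k)) s) = 0).
  { induction n as [|n IH]; intros s Hs; [exact (Hdep s Hs)|].
    assert (Hs' := Hs); apply in_words in Hs'; destruct Hs' as [Hsl HsF].
    assert (Hne : s <> nil) by (intros ->; simpl in Hsl; lia).
    (* The weight of the move from [s] to [tl s ++ [b]]. It depends on neither [n] nor [k], so it
       factors out of the relation. *)
    set (K := fun b => ind (forall g, In g G -> ~ exists t, s = g ++ t) *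
                       P (hd 0%nat s) (hd 0%nat (tl s ++ [b]))).
    transitivity (Rsum (seq 0 (S D)) (fun k => Rsum (seq 0 N) (fun b =>
       K b * (c k * ext_mass (n + (D - k)) (tl s ++ [b]))))).
    - apply Rsum_ext; intros k _; cbn [Nat.add].
      rewrite ext_mass_S, <- Rsum_scal_l by assumption.
      apply Rsum_ext; intros b _; unfold K; ring.
    - rewrite Rsum_swap; apply Rsum_0; intros b Hb; apply in_seq in Hb.
      rewrite Rsum_scal_l, IH; [ring|].
      apply in_words; destruct s as [|d s]; [congruence|]; inversion_clear HsF; simpl; split.
      + rewrite length_app; simpl in *; lia.
      + apply Forall_app; split; [assumption|repeat constructor; lia]. }
  intros n Hle.
  transitivity (Rsum (seq 0 (S D)) (fun k => Rsum (words N L) (fun s =>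
     p (hd 0%nat s) * (c k * ext_mass ((n - L - D) + (D - k)) s)))).
  - apply Rsum_ext; intros k Hk; apply in_seq in Hk.
    replace (n - k)%nat with (L + ((n - L - D) + (D - k)))%nat by lia.
    unfold L; rewrite avoid_mass_ext_mass, <- Rsum_scal_l by exact HL.
    apply Rsum_ext; intros s _; ring.
  - rewrite Rsum_swap; apply Rsum_0; intros s Hs; rewrite Rsum_scal_l, Hn by exact Hs; ring.
Qed.

End MarkovShift.

(** The cylinder of the empty word is the whole shift space, so if [G] contained that word no point
    would survive and the mass would be 0. *)
Lemma nil_notin_of_mu_W_pos N A p P G m : 0 < mu_W N A p P G m -> ~ In nil G.
Proof.
  intros HW Hin; unfold mu_W, mu_fin in HW.
  rewrite Rsum_0 in HW; [lra|]; intros w _.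
  rewrite ind_false; [ring|]; intros [Hal Hsub].
  destruct (allowed_cyl N A w Hal) as [x Hx].
  destruct (Hsub x Hx) as [Hx' Hav]; apply (Hav 0%nat); [lia|].
  exists nil; split; [exact Hin|split; [exact Hx'|intros t Ht; simpl in Ht; lia]].
Qed.

Theorem theorem4p4
  (N : nat) (A : nat -> nat -> bool) (P : nat -> nat -> R) (p : nat -> R)
  (G : list (list nat)) (rho : R)
  (hA : irreducible N A)
  (hP0 : forall i j, (i < N)%nat -> (j < N)%nat -> 0 <= P i j)
  (hPA : forall i j, (i < N)%nat -> (j < N)%nat -> (0 < P i j <-> A i j = true))
  (hProw : forall i, (i < N)%nat -> Rsum (seq 0 N) (fun j => P i j) = 1)
  (hp0 : forall i, (i < N)%nat -> 0 <= p i)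
  (hp1 : Rsum (seq 0 N) p = 1)
  (hpstat : forall j, (j < N)%nat -> Rsum (seq 0 N) (fun i => p i * P i j) = p j)
  (hGne : G <> nil)
  (hGall : forall g, In g G -> allowed N A g)
  (hGred : forall u v, In u G -> In v G -> u <> v -> ~ subword u v)
  (hWpos : forall m, 0 < mu_W N A p P G m)
  (hrho : is_lim_seq (fun m => - ln (mu_W N A p P G m) / INR m) rho) :
  CV_radius (Fcoef N A p P G) = Finite (exp rho) /\
  is_pole_of_pseries (Fcoef N A p P G) (exp rho).
Proof.
  assert (HGnil := nil_notin_of_mu_W_pos N A p P G 0 (hWpos 0%nat)).
  assert (HL : (1 <= maxlen G)%nat).
  { destruct G as [|g G']; [congruence|].
    assert (Hg := length_le_maxlen (g :: G') g (or_introl eq_refl)).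
    destruct g as [|x g]; [exfalso; apply HGnil; left; reflexivity|simpl length in Hg; lia]. }
  assert (HF : forall n, (1 <= n)%nat -> Fcoef N A p P G n = avoid_mass N P p G n).
  { intros [|n] Hn; [lia|]; apply Fcoef_avoid_mass; assumption. }
  destruct (stationary_lower_bound N A P p) as (c & Hc & Hcp); try assumption.
  assert (HWa : forall m, mu_W N A p P G m <= Fcoef N A p P G (S m)).
  { intros m; rewrite HF by lia; apply mu_W_le_avoid_mass; assumption. }
  assert (HaW : forall m, Fcoef N A p P G (m + maxlen G) <= mu_W N A p P G m).
  { intros m; rewrite HF by lia; apply avoid_mass_le_mu_W; try assumption; lia. }
  (* The submultiplicativity constant is [/ c], so the lower bound has the prefactor [c] itself. *)
  assert (Hlow : forall n, (1 <= n)%nat -> / / c * (/ exp rho) ^ n <= Fcoef N A p P G n).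
  { apply submultiplicative_lower_bound with (mu_W N A p P G); try assumption.
    - apply Rinv_0_lt_compat, Hc.
    - intros m n Hm Hn; rewrite !HF by lia; eapply avoid_mass_submult; eassumption. }
  rewrite Rinv_inv in Hlow.
  assert (Hrad : CV_radius (Fcoef N A p P G) = Finite (exp rho)).
  { apply CV_radius_exp_rate with (mu_W N A p P G) c (maxlen G); assumption. }
  split; [exact Hrad|].
  destruct (avoid_mass_recurrence N P p G HL) as (D & q & (i & Hi & Hqi) & Hrec).
  apply pole_of_rational_pseries with c (map (fun k => RtoC (q k)) (seq 0 (S D))) (maxlen G + D)%nat;
    try assumption.
  - apply exp_pos.
  - reflexivity.
  - exists (RtoC (q i)); split.
    + apply (in_map (fun k => RtoC (q k))), in_seq; lia.
    + intros E; apply RtoC_inj in E; contradiction.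
  - intros n Hn; rewrite pmul_RtoC by lia; f_equal.
    rewrite <- (Hrec n Hn); apply Rsum_ext; intros k Hk; apply in_seq in Hk.
    rewrite HF by lia; reflexivity.
Qed.
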